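(* Assume that for all integers $0\le M,N\le 2s$ there exist a non-trivial admissible solution $dS_+^{M(i)}=\{y_1,\dots,y_{2s}\}$ of the dual inhomogeneous Bethe equations $\tilde E_+(y_j,\bar y_j)=0$ ($j=1,\dots,2s$) satisfying $$\theta_M=q^{4s}\Big(\mathsf b^*(\zeta^2+\zeta^{-2})[2s]_q+q^{-2s}(\mathsf b q^{2s}+\mathsf c q^{-2s})-q^{-1}\mathsf b^*\sum_{j=1}^{2s}(qy_j^2+q^{-1}y_j^{-2})\Big),$$ and a non-trivial admissible solution $dS_-^{*N(i)}=\{v_1,\dots,v_{2s}\}$ of the dual inhomogeneous Bethe equations $\tilde E_-(v_j,\bar v_j)=0$ ($j=1,\dots,2s$) satisfying $$\theta^*_N=q^{-4s}\Big(\mathsf c(\zeta^2+\zeta^{-2})[2s]_q+q^{2s}(\mathsf b^*q^{2s}+\mathsf c^*q^{-2s})-q\mathsf c\sum_{j=1}^{2s}(qv_j^2+q^{-1}v_j^{-2})\Big).$$ Then for all $0\le M,N\le 2s$: $$\langle\theta_M|=\tilde{\mathcal N}^{(i)}_M(\bar v')\,\langle\Psi_+^{2s}(\bar v',m_0)|\quad\text{for }\bar v'=dS_+^{M(i)},\qquad\langle\theta^*_N|=\tilde{\mathcal N}^{*(i)}_N(\bar y')\,\langle\Psi_-^{2s}(\bar y',m_0)|\quad\text{for }\bar y'=dS_-^{*N(i)},$$ with $$\tilde{\mathcal N}^{(i)}_M(\bar v')=\tilde{\mathcal N}^*_{2s}(\bar v')\,P_{M,2s}\frac{\xi_M}{\xi^*_{2s}},\qquad\tilde{\mathcal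 N}^{*(i)}_N(\bar y')=\tilde{\mathcal N}_{2s}(\bar y')\,(P^{-1})_{N,2s}\frac{\xi^*_N}{\xi_{2s}}.$$
   Context: **Setting.** $q\in\mathbb C^*$ is not a root of unity; $[X,Y]_q=qXY-q^{-1}YX$; $[n]_q=\frac{q^n-q^{-n}}{q-q^{-1}}$; $b(x)=x-x^{-1}$. $s\ge 0$ is an integer or half-integer. $\mathsf b,\mathsf c,\mathsf b^*,\mathsf c^*,\zeta\in\mathbb C^*$ are generic subject to $\mathsf b\mathsf c=\mathsf b^*\mathsf c^*$ (in particular all quantities below are well defined). Put $\theta_M=\mathsf b q^{2M}+\mathsf c q^{-2M}$, $\theta^*_N=\mathsf b^*q^{2N}+\mathsf c^*q^{-2N}$, $\rho=-\mathsf b\mathsf c(q^2-q^{-2})^2$, $\omega=(q-q^{-1})^2\big(\mathsf b\mathsf c(\zeta^2+\zeta^{-2})(q^{2s+1}+q^{-2s-1})-(\mathsf b q^{2s}+\mathsf c q^{-2s})(\mathsf b^*q^{2s}+\mathsf c^*q^{-2s})\big)$, $\eta=-\frac{(q^2-q^{-2})^2}{q+q^{-1}}\mathsf b\mathsf c\big((\mathsf b q^{2s}+\mathsf c q^{-2s})(\zeta^2+\zeta^{-2})-(\mathsf b^*q^{2s}+\mathsf c^*q^{-2s})(q^{2s+1}+q^{-2s-1})\big)$, and $\eta^*$ is obtained from $\eta$ by exchanging $(\mathsf b,\mathsf c)\leftrightarrow(\mathsf b^*,\mathsf c^* )$. $\mathcal V$ is a complex vector space of dimension $2s+1$, and $A,A^*\in\mathrm{End}(\mathcal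 V)$ (the images $\pi(\mathsf A),\pi(\mathsf A^* )$ of the generators of the Askey-Wilson algebra) are diagonalizable, multiplicity-free, act irreducibly on $\mathcal V$, have eigenvalues $\{\theta_M\}_{M=0}^{2s}$ and $\{\theta^*_N\}_{N=0}^{2s}$ respectively, and satisfy the Askey-Wilson relations $[A,[A,A^*]_q]_{q^{-1}}=\rho A^*+\omega A+\eta I$, $[A^*,[A^*,A]_q]_{q^{-1}}=\rho A+\omega A^*+\eta^*I$. They form a Leonard pair: there are eigenbases $A|\theta_M\rangle=\theta_M|\theta_M\rangle$, $A^*|\theta^*_N\rangle=\theta^*_N|\theta^*_N\rangle$ ($0\le M,N\le 2s$) with $A^*|\theta_M\rangle=A^*_{M+1,M}|\theta_{M+1}\rangle+A^*_{M,M}|\theta_M\rangle+A^*_{M-1,M}|\theta_{M-1}\rangle$ and $A|\theta^*_N\rangle=A_{N+1,N}|\theta^*_{N+1}\rangle+A_{N,N}|\theta^*_N\rangle+A_{N-1,N}|\theta^*_{N-1}\rangle$, normalized so that $|\theta^*_0\rangle=\sum_M|\theta_M\rangle$ and $$A^*_{M,M-1}=q^{2-4s}\frac{(1-q^{2M})(\mathsf c-\mathsf b q^{2M+4s})(\mathsf b^*q^{2s-1}\zeta^{-2}+\mathsf b q^{2M-2})(\mathsf c q^{2s-1}\zeta^2+\mathsf c^*q^{2M-2})}{(\mathsf c-\mathsf b q^{4M-2})(\mathsf c-\mathsf b q^{4M})},$$ $$A^*_{M-1,M}=\frac{(1-q^{2M-4s-2})(\mathsf c-\mathsf b q^{2M-2})(\mathsf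 c+\mathsf b^*\zeta^{-2}q^{2M+2s-1})(\mathsf c^*+\mathsf b\zeta^2q^{2M+2s-1})}{(\mathsf c-\mathsf b q^{4M-4})(\mathsf c-\mathsf b q^{4M-2})},$$ $A^*_{M,M}=\theta^*_0-A^*_{M,M+1}-A^*_{M,M-1}$, the coefficients $A_{N,N'}$ being obtained by $(\mathsf b,\mathsf c,\zeta,M)\leftrightarrow(\mathsf b^*,\mathsf c^*,\zeta^{-1},N)$. The transition matrix $P$ is defined by $|\theta^*_N\rangle=\sum_M P_{MN}|\theta_M\rangle$, so $|\theta_M\rangle=\sum_N(P^{-1})_{NM}|\theta^*_N\rangle$. $\tilde{\mathcal V}$ is the dual space, $\langle\cdot|\cdot\rangle$ the pairing $\tilde{\mathcal V}\times\mathcal V\to\mathbb C$; $\langle\theta_M|,\langle\theta^*_N|\in\tilde{\mathcal V}$ are nonzero left eigenvectors, $\langle\theta_M|A=\theta_M\langle\theta_M|$, $\langle\theta^*_N|A^*=\theta^*_N\langle\theta^*_N|$, with arbitrary fixed normalizations $\langle\theta_{M'}|\theta_M\rangle=\delta_{MM'}\xi_M$, $\langle\theta^*_{N'}|\theta^*_N\rangle=\delta_{NN'}\xi^*_N$, $\xi_M,\xi^*_N\neq0$. Then $\langle\theta_M|A^*=\sum_{M'}\tilde A^*_{M,M'}\langle\theta_{M'}|$ and $\langle\theta^*_N|A=\sum_{N'}\tilde A_{N,N'}\langle\theta^*_{N'}|$ with $\tilde A^*_{M,M'}=A^*_{M,M'}\xi_M/\xi_{M'}$, $\tilde A_{N,N'}=A_{N,N'}\xi^*_N/\xi^*_{N'}$.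 The dual reference states are $\langle\Omega^-|=\langle\theta_0|$, $\langle\Omega^+|=\langle\theta^*_0|$. **Dual Bethe states.** Fix $\chi\in\mathbb C^*$ and an integer $m_0$. Put $$\mathcal B(u)=\chi\,b(u^2)\Big(\rho^{-1}\big([A^*,A]_q+\tfrac{\omega}{q-q^{-1}}I\big)+\tfrac{qu^2+q^{-1}u^{-2}}{q^2-q^{-2}}I\Big).$$ - $\langle\Psi_-^{2s}(\bar v,m_0)|=\langle\Omega^-|\mathscr C^-(v_1,m_0+2)\cdots\mathscr C^-(v_{2s},m_0+4s)$, where $\mathscr C^-(v,m)=\beta^{-1}q^{2-m}v\,\mathcal B(v)$ with $(q^2-q^{-2})\chi^{-1}\beta\,\mathsf c\,q^{m_0-2}=-1$. - $\langle\Psi_+^{2s}(\bar y,m_0)|=\langle\Omega^+|\mathscr C^+(y_1,m_0+2)\cdots\mathscr C^+(y_{2s},m_0+4s)$, where $\mathscr C^+(v,m)=\beta^{-1}q^{m-2}v^{-1}\mathcal B(v)$ with $(q^2-q^{-2})\chi^{-1}\beta\,\mathsf b^*q^{-m_0+2}=1$. **Normalization.** $\tilde{\mathcal N}_{2s}(\bar v)=\prod_{k=1}^{2s}\big(q^{-1}v_k\,b(v_k^2)\tilde A^*_{k-1,k}\big)^{-1}$, $\tilde{\mathcal N}^*_{2s}(\bar y)=\prod_{k=1}^{2s}\big(-q\,y_k^{-1}b(y_k^2)\tilde A_{k-1,k}\big)^{-1}$. **Dual inhomogeneous Bethe equations.** $f(u,v)=\frac{b(qv/u)b(uv)}{b(v/u)b(quv)}$,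 $h(u,v)=\frac{b(q^2uv)b(qu/v)}{b(quv)b(u/v)}$. For $\epsilon=\pm1$, $$\Lambda_1^\epsilon(u)=\tfrac{q^{-2s-1}}{u^\epsilon}(q^{2s+1}u\zeta^{-1}-u^{-1}\zeta)(q^{2s+1}u\zeta-u^{-1}\zeta^{-1})(u\mathsf c^*q^{-2s}+u^{-1}\mathsf b q^{2s})\Big(u(\tfrac{\mathsf c}{\mathsf c^*})^{\frac{1-\epsilon}2}+u^{-1}(\tfrac{\mathsf b^*}{\mathsf b})^{\frac{1+\epsilon}2}\Big),$$ $$\Lambda_2^\epsilon(u)=\tfrac{(u^2-u^{-2})q^{-2s-1}}{u^\epsilon(qu^2-q^{-1}u^{-2})}(q^{2s-1}u^{-1}\zeta-u\zeta^{-1})(q^{2s-1}u^{-1}\zeta^{-1}-u\zeta)(q^2u\mathsf b q^{2s}+u^{-1}\mathsf c^*q^{-2s})\Big(q^2u(\tfrac{\mathsf b^*}{\mathsf b})^{\frac{1+\epsilon}2}+u^{-1}(\tfrac{\mathsf c}{\mathsf c^*})^{\frac{1-\epsilon}2}\Big).$$ With $\tilde\nu_+=q^{1+4s}\mathsf b^*$, $\tilde\nu_-=q^{-1-4s}\mathsf c$ and $1\le i,j\le 2s$: $$\tilde E_\pm(y_i,\bar y_i)=\frac{b(y_i^2)}{b(qy_i^2)}y_i^{\mp1}\prod_{j\ne i}f(y_i,y_j)\Lambda_1^{\pm}(y_i)-(q^2y_i^3)^{\pm1}\prod_{j\ne i}h(y_i,y_j)\Lambda_2^{\pm}(y_i)+\tilde\nu_\pm\frac{b(y_i^2)}{b(q)}\frac{\prod_{k=0}^{2s}b(q^{1/2+k-s}\zeta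 y_i)b(q^{1/2+k-s}\zeta^{-1}y_i)}{\prod_{j\neq i}b(y_iy_j^{-1})b(qy_iy_j)}.$$ A solution is *non-trivial* if $y_i\ne0$ and $y_i^2\neq y_i^{-2}$ for all $i$, and *admissible* if $Y_i\ne Y_j$ for $i\neq j$, where $Y_i=(qy_i^2+q^{-1}y_i^{-2})/(q+q^{-1})$; the equations are understood where defined ($b(qy_i^2)\ne0$). *)

(* Defs.v *)
(* The definitions make sense over any field F; they are used over C = R[i].
   Throughout, n stands for the integer 2s, so that s ranges over the
   nonnegative integers and half-integers as n ranges over nat. *)
From HB Require Import structures.
From mathcomp Require Import all_boot all_order all_algebra.
From mathcomp Require Import reals.
From mathcomp Require Export complex.

Set Implicit Arguments.
Unset Strict Implicit.
Unset Printing Implicit Defensive.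
Import Order.TTheory GRing.Theory Num.Theory.
Local Open Scope ring_scope.

Record awParam (F : fieldType) := AWParam {
  aw_q : F; aw_b : F; aw_c : F; aw_bs : F; aw_cs : F; aw_zeta : F }.

(* The exchange (b, c, zeta) <-> (bs, cs, zeta^-1). *)
Definition dualp (F : fieldType) (p : awParam F) : awParam F :=
  let: AWParam q b c bs cs z := p in AWParam q bs cs b c z^-1.

Section Scalars.

Context {F : fieldType}.
Implicit Types (p : awParam F) (n : nat) (M k : int) (x u v : F).

Definition bfun x : F := x - x^-1.

Definition qnum (q : F) n : F := (q ^+ n - q ^- n) / (q - q^-1).

Definition theta p M : F :=
  let: AWParam q b c bs cs z := p in b * q ^ (2 * M) + c * q ^ (- (2 * M)).

Definition theta_star p M : F := theta (dualp p) M.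

Definition rho p : F :=
  let: AWParam q b c bs cs z := p in - (b * c * (q ^+ 2 - q ^- 2) ^+ 2).

Definition omega n p : F :=
  let: AWParam q b c bs cs z := p in
  (q - q^-1) ^+ 2 *
    (b * c * (z ^+ 2 + z ^- 2) * (q ^+ n.+1 + q ^- n.+1)
     - (b * q ^+ n + c * q ^- n) * (bs * q ^+ n + cs * q ^- n)).

Definition eta n p : F :=
  let: AWParam q b c bs cs z := p in
  - ((q ^+ 2 - q ^- 2) ^+ 2 / (q + q^-1) * (b * c) *
     ((b * q ^+ n + c * q ^- n) * (z ^+ 2 + z ^- 2)
      - (bs * q ^+ n + cs * q ^- n) * (q ^+ n.+1 + q ^- n.+1))).

(* eta only depends on zeta through zeta^2 + zeta^-2, hence the inversion of
   zeta in dualp has no effect here. *)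
Definition eta_star n p : F := eta n (dualp p).

(* The entry A^*_{M, M-1}. *)
Definition coef_dn n p M : F :=
  let: AWParam q b c bs cs z := p in
  q ^ (2 - 2 * n%:Z) *
  ((1 - q ^ (2 * M)) * (c - b * q ^ (2 * M + 2 * n%:Z))
   * (bs * q ^ (n%:Z - 1) * z ^- 2 + b * q ^ (2 * M - 2))
   * (c * q ^ (n%:Z - 1) * z ^+ 2 + cs * q ^ (2 * M - 2))
   / ((c - b * q ^ (4 * M - 2)) * (c - b * q ^ (4 * M)))).

(* The entry A^*_{M-1, M}. *)
Definition coef_up n p M : F :=
  let: AWParam q b c bs cs z := p in
  (1 - q ^ (2 * M - 2 * n%:Z - 2)) * (c - b * q ^ (2 * M - 2))
   * (c + bs * z ^- 2 * q ^ (2 * M + n%:Z - 1))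
   * (cs + b * z ^+ 2 * q ^ (2 * M + n%:Z - 1))
   / ((c - b * q ^ (4 * M - 4)) * (c - b * q ^ (4 * M - 2))).

(* The tridiagonal matrix of A^* in the basis |theta_M>, column M holding the
   coefficients of A^* |theta_M>.  The diagonal entries use coef_dn 0 and
   coef_up n.+1, which vanish because of their factors 1 - q^0. *)
Definition Astar_mx n p : 'M[F]_n.+1 :=
  \matrix_(i, j)
    if i == j.+1 :> nat then coef_dn n p i%:Z
    else if j == i.+1 :> nat then coef_up n p j%:Z
    else if i == j then theta_star p 0 - coef_up n p (i%:Z + 1) - coef_dn n p i%:Z
    else 0.

(* The tridiagonal matrix of A in the basis |theta^*_N>. *)
Definition A_mx n p : 'M[F]_n.+1 := Astar_mx n (dualp p).

(* The coefficients of the action on left eigenvectors. *)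
Definition tilde n (T : 'M[F]_n.+1) (xi : 'I_n.+1 -> F) (i j : 'I_n.+1) : F :=
  T i j * xi i / xi j.

(* With i < n standing for k - 1, the pair (widen_ord _ i, lift ord0 i) of
   elements of 'I_n.+1 is (k - 1, k), and v i is v_k. *)
Definition Ntilde n p (xi : 'I_n.+1 -> F) (v : 'I_n -> F) : F :=
  \prod_(i < n)
    ((aw_q p)^-1 * v i * bfun (v i ^+ 2)
     * tilde (Astar_mx n p) xi (widen_ord (leqnSn n) i) (lift ord0 i))^-1.

Definition Ntilde_star n p (xis : 'I_n.+1 -> F) (y : 'I_n -> F) : F :=
  \prod_(i < n)
    (- aw_q p * (y i)^-1 * bfun (y i ^+ 2)
     * tilde (A_mx n p) xis (widen_ord (leqnSn n) i) (lift ord0 i))^-1.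

Definition ffun_bethe (q u v : F) : F :=
  bfun (q * v / u) * bfun (u * v) / (bfun (v / u) * bfun (q * u * v)).

Definition hfun_bethe (q u v : F) : F :=
  bfun (q ^+ 2 * u * v) * bfun (q * u / v) / (bfun (q * u * v) * bfun (u / v)).

(* The sign epsilon is encoded by a boolean e, true standing for +1; then
   (1 + epsilon)/2 is e and (1 - epsilon)/2 is ~~ e, both as naturals. *)
Definition sgb (e : bool) : int := if e then 1 else -1.

Definition Lambda1 n p (e : bool) u : F :=
  let: AWParam q b c bs cs z := p in
  q ^- n.+1 / u ^ sgb e
  * (q ^+ n.+1 * u * z^-1 - u^-1 * z)
  * (q ^+ n.+1 * u * z - u^-1 * z^-1)
  * (u * cs * q ^- n + u^-1 * b * q ^+ n)
  * (u * (c / cs) ^+ (~~ e) + u^-1 * (bs / b) ^+ e).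

Definition Lambda2 n p (e : bool) u : F :=
  let: AWParam q b c bs cs z := p in
  (u ^+ 2 - u ^- 2) * q ^- n.+1
    / (u ^ sgb e * (q * u ^+ 2 - q^-1 * u ^- 2))
  * (q ^ (n%:Z - 1) * u^-1 * z - u * z^-1)
  * (q ^ (n%:Z - 1) * u^-1 * z^-1 - u * z)
  * (q ^+ 2 * u * b * q ^+ n + u^-1 * cs * q ^- n)
  * (q ^+ 2 * u * (bs / b) ^+ e + u^-1 * (c / cs) ^+ (~~ e)).

Definition nu_tilde n p (e : bool) : F :=
  let: AWParam q b c bs cs z := p in
  if e then q ^+ (1 + 2 * n) * bs else q ^- (1 + 2 * n) * c.

(* qh is a square root of q, so that q^{1/2+k-s} is qh^{1+2k-n}. *)
Definition Etilde n p (qh : F) (e : bool) (y : 'I_n -> F) (i : 'I_n) : F :=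
  let: AWParam q b c bs cs z := p in
  bfun (y i ^+ 2) / bfun (q * y i ^+ 2) * y i ^ (- sgb e)
    * (\prod_(j < n | j != i) ffun_bethe q (y i) (y j)) * Lambda1 n p e (y i)
  - (q ^+ 2 * y i ^+ 3) ^ sgb e
    * (\prod_(j < n | j != i) hfun_bethe q (y i) (y j)) * Lambda2 n p e (y i)
  + nu_tilde n p e * (bfun (y i ^+ 2) / bfun q)
    * ((\prod_(k < n.+1)
          (bfun (qh ^ (1 + 2 * k%:Z - n%:Z) * z * y i)
           * bfun (qh ^ (1 + 2 * k%:Z - n%:Z) * z^-1 * y i)))
       / (\prod_(j < n | j != i)
            (bfun (y i * (y j)^-1) * bfun (q * y i * y j)))).

Definition nontrivial n (y : 'I_n -> F) : Prop :=
  forall i, y i != 0 /\ y i ^+ 2 != y i ^- 2.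

Definition Yfun (q u : F) : F := (q * u ^+ 2 + q^-1 * u ^- 2) / (q + q^-1).

Definition admissible n (q : F) (y : 'I_n -> F) : Prop :=
  forall i j, i != j -> Yfun q (y i) != Yfun q (y j).

(* The condition b(q y_i^2) != 0 makes the equations well defined; the other
   denominators are nonzero for admissible y with nonzero entries. *)
Definition dual_bethe_solution n p (qh : F) (e : bool) (y : 'I_n -> F) : Prop :=
  [/\ nontrivial y, admissible (aw_q p) y,
      forall i, bfun (aw_q p * y i ^+ 2) != 0
    & forall i, Etilde p qh e y i = 0].

Definition eigval_plus n p (y : 'I_n -> F) : F :=
  let: AWParam q b c bs cs z := p in
  q ^+ (2 * n) *
    (bs * (z ^+ 2 + z ^- 2) * qnum q n
     + q ^- n * (b * q ^+ n + c * q ^- n)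
     - q^-1 * bs * \sum_(j < n) (q * y j ^+ 2 + q^-1 * y j ^- 2)).

Definition eigval_minus n p (v : 'I_n -> F) : F :=
  let: AWParam q b c bs cs z := p in
  q ^- (2 * n) *
    (c * (z ^+ 2 + z ^- 2) * qnum q n
     + q ^+ n * (bs * q ^+ n + cs * q ^- n)
     - q * c * \sum_(j < n) (q * v j ^+ 2 + q^-1 * v j ^- 2)).

Definition dS_plus n p (qh : F) (M : 'I_n.+1) (y : 'I_n -> F) : Prop :=
  dual_bethe_solution p qh true y /\ theta p M%:Z = eigval_plus p y.

Definition dS_minus n p (qh : F) (N : 'I_n.+1) (v : 'I_n -> F) : Prop :=
  dual_bethe_solution p qh false v /\ theta_star p N%:Z = eigval_minus p v.

(* Genericity is spelled out as the nonvanishing of the denominators of the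
   matrix entries; distinctness of the eigenvalues and irreducibility are part
   of AW_Leonard_pair below. *)
Definition generic_param n p : Prop :=
  let: AWParam q b c bs cs z := p in
  [/\ [/\ b != 0, c != 0, bs != 0, cs != 0 & z != 0],
      b * c = bs * cs
    & forall k : nat, (k <= 2 * n)%N ->
        c - b * q ^+ (2 * k) != 0 /\ cs - bs * q ^+ (2 * k) != 0].

Definition not_root_of_unity (q : F) : Prop :=
  q != 0 /\ forall k : nat, (0 < k)%N -> q ^+ k != 1.

End Scalars.

Section Operators.

Context {F : fieldType} {V : vectType F}.
Implicit Types (p : awParam F) (n : nat) (A As : 'End(V)).

Definition qcomm (q : F) (X Y : 'End(V)) : 'End(V) :=
  (q *: (X \o Y) - q^-1 *: (Y \o X))%VF.

(* ket M is |theta_M> and kets N is |theta^*_N>.  Distinctness of the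
   eigenvalues together with the eigenbases says that A and As are
   diagonalizable and multiplicity-free. *)
Record AW_Leonard_pair n p A As (ket kets : 'I_n.+1 -> V) : Prop := {
  AW_dim : \dim {:V} = n.+1;
  AW_irreducible : forall W : {vspace V},
    (A @: W <= W)%VS -> (As @: W <= W)%VS -> W = 0%VS \/ W = fullv;
  AW_rel1 : qcomm (aw_q p)^-1 A (qcomm (aw_q p) A As)
            = rho p *: As + omega n p *: A + eta n p *: \1%VF;
  AW_rel2 : qcomm (aw_q p)^-1 As (qcomm (aw_q p) As A)
            = rho p *: A + omega n p *: As + eta_star n p *: \1%VF;
  AW_theta_inj : injective (fun M : 'I_n.+1 => theta p M%:Z);
  AW_theta_star_inj : injective (fun N : 'I_n.+1 => theta_star p N%:Z);
  AW_ket_basis : basis_of fullv (codom ket);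
  AW_kets_basis : basis_of fullv (codom kets);
  AW_ket_eigen : forall M, A (ket M) = theta p M%:Z *: ket M;
  AW_kets_eigen : forall N, As (kets N) = theta_star p N%:Z *: kets N;
  AW_ket_tridiag : forall M,
    As (ket M) = \sum_(M' < n.+1) Astar_mx n p M' M *: ket M';
  AW_kets_tridiag : forall N,
    A (kets N) = \sum_(N' < n.+1) A_mx n p N' N *: kets N';
  AW_normalization : kets ord0 = \sum_(M < n.+1) ket M
}.

(* P is the transition matrix: |theta^*_N> = \sum_M P_{MN} |theta_M>. *)
Definition transition_matrix n (ket kets : 'I_n.+1 -> V) (P : 'M[F]_n.+1) :=
  forall N, kets N = \sum_(M < n.+1) P M N *: ket M.

(* A left vector is a linear form f : 'Hom(V, F^o), on which X : 'End(V) acts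
   by <f| X = (f \o X)%VF. *)
Definition left_eigenbasis n (X : 'End(V)) (ev : 'I_n.+1 -> F)
    (ket : 'I_n.+1 -> V) (bra : 'I_n.+1 -> 'Hom(V, F^o)) (xi : 'I_n.+1 -> F) :=
  [/\ forall M, (bra M \o X)%VF = ev M *: bra M,
      forall M' M, bra M' (ket M) = if M' == M then xi M else 0
    & forall M, xi M != 0].

Definition Bop n p A As (chi u : F) : 'End(V) :=
  let q := aw_q p in
  (chi * bfun (u ^+ 2)) *:
    ((rho p)^-1 *: (qcomm q As A + (omega n p / (q - q^-1)) *: \1%VF)
     + ((q * u ^+ 2 + q^-1 * u ^- 2) / (q ^+ 2 - q ^- 2)) *: \1%VF).

Definition Cminus n p A As (chi beta v : F) (m : int) : 'End(V) :=
  (beta^-1 * aw_q p ^ (2 - m) * v) *: Bop n p A As chi v.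

Definition Cplus n p A As (chi beta v : F) (m : int) : 'End(V) :=
  (beta^-1 * aw_q p ^ (m - 2) * v^-1) *: Bop n p A As chi v.

(* <Omega| C(v_1, m0 + 2) C(v_2, m0 + 4) ... C(v_n, m0 + 2 n); the element
   i : 'I_n indexes v_{i+1}. *)
Definition dual_string n (Om : 'Hom(V, F^o)) (Cop : F -> int -> 'End(V))
    (v : 'I_n -> F) (m0 : int) : 'Hom(V, F^o) :=
  (Om \o \big[(@comp_lfun F V V V)/(\1%VF)]_(i < n)
           Cop (v i) (m0 + 2 * i.+1%:Z))%VF.

Definition Psi_minus n p A As (bra : 'I_n.+1 -> 'Hom(V, F^o))
    (chi beta : F) (m0 : int) (v : 'I_n -> F) : 'Hom(V, F^o) :=
  dual_string (bra ord0) (Cminus n p A As chi beta) v m0.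

Definition Psi_plus n p A As (bras : 'I_n.+1 -> 'Hom(V, F^o))
    (chi beta : F) (m0 : int) (y : 'I_n -> F) : 'Hom(V, F^o) :=
  dual_string (bras ord0) (Cplus n p A As chi beta) y m0.

End Operators.

(* Main.v *)
(* For the plus string put W := -(q^2 - q^-2) X with
   rho X = [A^*, A]_q + omega / (q - q^-1), so that B(u) is a multiple of
   W - Z(u), Z(u) = q u^2 + q^-1 u^-2.  The Askey-Wilson relations become
   q-commutation relations of W with A and A^*, hence the left vector
   e = <theta^*_0|, for which e A is a combination of e W and e, satisfies
   e f(W) A = e (T f)(W) for all polynomials f, where T is an explicit
   second-order q-difference operator.  The product in the inhomogeneous term
   of the Bethe equations is, up to a scalar, a polynomial chi in W with
   e chi(W) = 0, and for f = \prod_j ('X - Z(y_j)) the Bethe equations say that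
   T f - nu chi vanishes at the n distinct zeros of f; comparing the two
   leading coefficients, T f = nu chi + theta_M f.  So e f(W) is a left
   eigenvector of A, and its normalization is read off the coefficient of
   <theta^*_{2s}|, which only involves the entries W_{k-1,k}.  The minus string
   is the plus string of the data obtained by exchanging A and A^* and
   replacing q by q^-1. *)
Require Import Defs.
From HB Require Import structures.
From mathcomp Require Import all_boot all_order all_algebra.
From mathcomp Require Import reals.
From mathcomp Require Import ring zify.
Set Implicit Arguments.
Unset Strict Implicit.
Unset Printing Implicit Defensive.
Import Order.TTheory GRing.Theory Num.Theory.
Local Open Scope ring_scope.

(** * Polynomial model of the Askey-Wilson algebra *)

Section PolynomialModel.

Context {F : fieldType}.
(* t stands for q^(2s). *)
Variables q t b c bs cs z : F.

Definition Zfun (u : F) : F := q * u ^+ 2 + q^-1 * u ^- 2.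
Definition zt : F := z ^+ 2 + z ^- 2.
Definition gA : F :=
  - ((q - q^-1) * ((b * t + c / t) * zt - (bs * t + cs / t) * (q * t + (q * t)^-1))).
Definition gS : F :=
  - ((q - q^-1) * ((bs * t + cs / t) * zt - (b * t + c / t) * (q * t + (q * t)^-1))).
Definition kap : F := - (q ^+ 2 - q ^- 2).
(** The constant in e A = q bs e W + beta e. Together with theta^*_0 = bs + cs it gives the initial
    data of the recursion below: [actA1] is T 1 and [actS1] is S 1. *)
Definition beta : F := b + c * t ^- 2 - q * t * bs * zt.

Definition actA1 : {poly F} := (q * bs) *: 'X + beta%:P.
Definition actS1 : {poly F} := (bs + cs)%:P.

(* [act s] is the pair (T f, S f) for f with coefficient list s, where T and S
   are determined by e f(W) A = e (T f)(W) and e f(W) A^* = e (S f)(W); the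
   recursion moves one factor W through A and A^*.  The constants gA and gS are
   kap eta / rho and kap eta^* / rho. *)
Fixpoint act (s : seq F) : {poly F} * {poly F} :=
  if s is x :: s' then let TS := act s' in
    (x *: actA1 + (q ^+ 2 *: (TS.1 * 'X) + (q * kap) *: TS.2 + (q * gA) *: Poly s'),
     x *: actS1 + (q ^- 2 *: (TS.2 * 'X) - (q^-1 * kap) *: TS.1 - (q^-1 * gS) *: Poly s'))
  else (0, 0).

Definition actA (f : {poly F}) := (act f).1.
Definition actS (f : {poly F}) := (act f).2.

Lemma act_cons (x : F) (f : {poly F}) :
  act (f * 'X + x%:P) =
    (x *: actA1 + (q ^+ 2 *: (actA f * 'X) + (q * kap) *: actS f + (q * gA) *: f),
     x *: actS1 + (q ^- 2 *: (actS f * 'X) - (q^-1 * kap) *: actA f - (q^-1 * gS) *: f)).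
Proof.
(* The coefficient list is x followed by that of f, except for f = 0, where a zero x is dropped;
   both sides then agree because [act] of the empty list is zero. *)
rewrite -cons_poly_def polyseq_cons /actA /actS.
case: nilP => [f0|_] /=; last by rewrite polyseqK.
have -> : f = 0 by apply/poly_inj; rewrite f0 polyseq0.
rewrite polyseqC polyseq0 /= !(mul0r, scaler0, addr0, subr0).
by case: eqP => [->|_] /=; rewrite ?scale0r //= !(mul0r, scaler0, addr0, subr0).
Qed.

Lemma actA_cons x f : actA (f * 'X + x%:P) =
  x *: actA1 + (q ^+ 2 *: (actA f * 'X) + (q * kap) *: actS f + (q * gA) *: f).
Proof. by rewrite /actA act_cons. Qed.

Lemma actS_cons x f : actS (f * 'X + x%:P) =
  x *: actS1 + (q ^- 2 *: (actS f * 'X) - (q^-1 * kap) *: actA f - (q^-1 * gS) *: f).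
Proof. by rewrite /actS act_cons. Qed.

Lemma actA0 : actA 0 = 0. Proof. by rewrite /actA polyseq0. Qed.
Lemma actS0 : actS 0 = 0. Proof. by rewrite /actS polyseq0. Qed.

Lemma actAX f : actA (f * 'X) =
  q ^+ 2 *: (actA f * 'X) + (q * kap) *: actS f + (q * gA) *: f.
Proof. by rewrite -[f * 'X]addr0 -(polyC0 F) actA_cons scale0r add0r. Qed.

Lemma actSX f : actS (f * 'X) =
  q ^- 2 *: (actS f * 'X) - (q^-1 * kap) *: actA f - (q^-1 * gS) *: f.
Proof. by rewrite -[f * 'X]addr0 -(polyC0 F) actS_cons scale0r add0r. Qed.

(** The recursion couples T and S, so linearity of both is proved in one induction. *)
Lemma act_lin a f g :
  actA (a *: f + g) = a *: actA f + actA g /\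
  actS (a *: f + g) = a *: actS f + actS g.
Proof.
elim/poly_ind: f g => [|f x IH] g; first by rewrite actA0 actS0 !scaler0 !add0r.
have [h [y ->]] : exists h y, g = h * 'X + y%:P.
  elim/poly_ind: g => [|h y _]; last by exists h, y.
  by exists 0, 0; rewrite mul0r add0r.
have -> : a *: (f * 'X + x%:P) + (h * 'X + y%:P) = (a *: f + h) * 'X + (a * x + y)%:P.
  by rewrite -!mul_polyC !(polyCD, polyCM); ring.
rewrite !actA_cons !actS_cons; have [-> ->] := IH h.
by split; rewrite -!mul_polyC !(polyCD, polyCM, polyCB); ring.
Qed.

Lemma actA_lin a f g : actA (a *: f + g) = a *: actA f + actA g.
Proof. by case: (act_lin a f g). Qed.

Lemma actS_lin a f g : actS (a *: f + g) = a *: actS f + actS g.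
Proof. by case: (act_lin a f g). Qed.

Lemma actA_X_sub x f : actA (f * ('X - x%:P)) = actA (f * 'X) - x *: actA f.
Proof.
have -> : f * ('X - x%:P) = (- x) *: f + f * 'X by rewrite -mul_polyC polyCN; ring.
by rewrite actA_lin scaleNr addrC.
Qed.

Lemma actS_X_sub x f : actS (f * ('X - x%:P)) = actS (f * 'X) - x *: actS f.
Proof.
have -> : f * ('X - x%:P) = (- x) *: f + f * 'X by rewrite -mul_polyC polyCN; ring.
by rewrite actS_lin scaleNr addrC.
Qed.

Lemma actA_1 : actA 1 = actA1.
Proof.
rewrite -[1]add0r -(mul0r 'X) -[X in actA (_ + X)]polyC1 actA_cons actA0 actS0.
by rewrite mul0r !scaler0 !addr0 scale1r.
Qed.

Lemma actS_1 : actS 1 = actS1.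
Proof.
rewrite -[1]add0r -(mul0r 'X) -[X in actS (_ + X)]polyC1 actS_cons actA0 actS0.
by rewrite mul0r !scaler0 !subr0 addr0 scale1r.
Qed.

(** S does not raise the degree, so in the recursion the terms with S f and f never reach the two
    top coefficients of T. The factor [(0 < k)%:R] suppresses the lower coefficient of f for k = 0,
    where its index [k.-1] collapses to 0. *)
Lemma act_top (k : nat) (f : {poly F}) : q != 0 -> (size f <= k.+1)%N ->
  [/\ (size (actA f) <= k.+2)%N, (size (actS f) <= k.+1)%N,
      (actA f)`_k.+1 = q * q ^+ k ^+ 2 * bs * f`_k
    & (actA f)`_k = q ^+ k ^+ 2 * (beta * f`_k + (0 < k)%:R * q^-1 * bs * f`_k.-1)].
Proof.
move=> q0; elim: k f => [|k IH] f.
  move=> /size1_polyC ->; set x := f`_0.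
  have -> : x%:P = x *: 1 + 0 by rewrite addr0 alg_polyC.
  rewrite actA_lin actS_lin actA_1 actS_1 actA0 actS0 !addr0 /actA1 /actS1.
  split; rewrite ?coefE /=; last 2 first.
  - by ring.
  - by rewrite !(mulr0, add0r, addr0, mul0r, expr0, expr1n, mul1r) mulrC mulr1.
  - apply: leq_trans (size_scale_leq _ _) _.
    apply: leq_trans (size_polyD _ _) _; rewrite geq_max.
    rewrite (leq_trans (size_scale_leq _ _)) ?size_polyX //=.
    by rewrite (leq_trans (size_polyC_leq1 _)).
  - apply: leq_trans (size_scale_leq _ _) _; exact: size_polyC_leq1.
elim/poly_ind: f => [|f x _] sf.
  by rewrite actA0 actS0 !coef0 !size_poly0 !mulr0 addr0 mulr0.
have sf' : (size f <= k.+1)%N.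
  move: sf; rewrite -cons_poly_def size_cons_poly.
  by case: ifP => [/andP[/nilP f0 _]|_ //]; rewrite f0.
have [sA sS cA1 cA0] := IH f sf'.
have e1 : f`_k.+1 = 0 by rewrite nth_default.
have e2 : (actS f)`_k.+1 = 0 by rewrite nth_default.
have e3 : (actS f)`_k.+2 = 0 by rewrite nth_default // ltnW.
have e4 : f`_k.+2 = 0 by rewrite nth_default // ltnW.
rewrite actA_cons actS_cons; split.
- apply: leq_trans (size_polyD _ _) _; rewrite geq_max; apply/andP; split.
    apply: leq_trans (size_scale_leq _ _) _; rewrite /actA1.
    apply: leq_trans (size_polyD _ _) _; rewrite geq_max.
    rewrite (leq_trans (size_scale_leq _ _)) ?size_polyX //=.
    by rewrite (leq_trans (size_polyC_leq1 _)).
  apply: leq_trans (size_polyD _ _) _; rewrite geq_max; apply/andP; split; last first.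
    apply: leq_trans (size_scale_leq _ _) _; apply: leq_trans sf' _.
    by rewrite (leqW (leqnSn _)).
  apply: leq_trans (size_polyD _ _) _; rewrite geq_max; apply/andP; split; last first.
    apply: leq_trans (size_scale_leq _ _) _; apply: leq_trans sS _.
    by rewrite (leqW (leqnSn _)).
  apply: leq_trans (size_scale_leq _ _) _; apply: leq_trans (size_polyMleq _ _) _.
  by rewrite size_polyX addn2.
- apply: leq_trans (size_polyD _ _) _; rewrite geq_max; apply/andP; split.
    apply: leq_trans (size_scale_leq _ _) _; apply: leq_trans (size_polyC_leq1 _) _.
    by [].
  apply: leq_trans (size_polyD _ _) _; rewrite geq_max size_polyN; apply/andP; split; last first.
    by apply: leq_trans (size_scale_leq _ _) _; rewrite (leq_trans sf').
  apply: leq_trans (size_polyD _ _) _; rewrite geq_max size_polyN; apply/andP; split; last first.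
    exact: leq_trans (size_scale_leq _ _) _.
  apply: leq_trans (size_scale_leq _ _) _; apply: leq_trans (size_polyMleq _ _) _.
  by rewrite size_polyX addn2.
- rewrite !coefE /= e3 e4 cA1 (exprS q k).
 ring.
- rewrite !coefE /= e1 ?e2 cA0 (exprS q k).
  case: k {IH sf sA sS cA1 cA0 e1 e2 e3 e4 sf'} => [|k] /=; rewrite ?expr0 ?coefE /=. all: field; exact: q0.
Qed.

End PolynomialModel.

(** * Values of T at a root, and the Newton basis *)

Section Evaluation.

Context {F : fieldType}.
Variables q t b c bs cs z : F.
Hypotheses (q0 : q != 0) (t0 : t != 0) (b0 : b != 0) (z0 : z != 0).
Hypothesis (bc : b * c = bs * cs).

Local Notation actA := (actA q t b c bs cs z).
Local Notation actS := (actS q t b c bs cs z).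
Local Notation Z := (Zfun q).

(** For t = q^(2s) these are the coefficients of the Bethe equations with a factor b(u^2) removed:
    [coefM u] is u^-1 Lambda_1^+(u) / b(q u^2), and [coefP u] is q^2 u^3 Lambda_2^+(u) / b(u^2)
    after cancellation. *)
Definition coefM (u : F) : F :=
  u^-1 * ((q * t)^-1 / u * (q * t * u * z^-1 - u^-1 * z) * (q * t * u * z - u^-1 * z^-1)
    * (u * cs * t^-1 + u^-1 * b * t) * (u + u^-1 * (bs / b))) / (q * u ^+ 2 - q^-1 * u ^- 2).

Definition coefP (u : F) : F :=
  q ^+ 2 * u ^+ 3 * ((q * t)^-1 / (u * (q * u ^+ 2 - q^-1 * u ^- 2))
    * (t * q^-1 * u^-1 * z - u * z^-1) * (t * q^-1 * u^-1 * z^-1 - u * z)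
    * (q ^+ 2 * u * b * t + u^-1 * cs * t^-1) * (q ^+ 2 * u * (bs / b) + u^-1)).

Let D (u : F) (f : {poly F}) := (actA (f * ('X - (Z u)%:P))).[Z u].

Let DE u f : D u f =
  (q ^+ 2 - 1) * Z u * (actA f).[Z u] + q * kap q * (actS f).[Z u] + q * gA q t b c bs cs z * f.[Z u].
Proof. rewrite /D actA_X_sub actAX !hornerE /=. ring. Qed.

Let D_lin u a f g : D u (a *: f + g) = a * D u f + D u g.
Proof. by rewrite !DE actA_lin actS_lin !hornerE /=; ring. Qed.

(** The characteristic roots of this recurrence are Z(qu) and Z(u/q): their sum is (q^2 + q^-2) Z(u)
    and their product Z(u)^2 + (q^2 - q^-2)^2. This is what makes T a q-difference operator. *)
Let D_rec u f : u != 0 ->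
  D u (f * 'X * 'X) = (q ^+ 2 + q ^- 2) * Z u * D u (f * 'X)
     - (Z u ^+ 2 + (q ^+ 2 - q ^- 2) ^+ 2) * D u f.
Proof.
move=> u0; rewrite !DE !(actAX, actSX) !hornerE /= /kap.
move: (gA _ _ _ _ _ _ _) (gS _ _ _ _ _ _ _) (Z u) => g1 g2 x4.
move: (actA f).[_] (actS f).[_] f.[_] => x1 x2 x3; field; exact: q0.
Qed.

(* T f involves the values of f at Z(u), Z(qu) and Z(u/q), with denominators
   b(u^2) b(q u^2) b(q^2 u^2).  At a zero Z(u) of its argument only b(q u^2)
   remains; proving the identity for f and f * 'X simultaneously avoids the
   other two factors, which may vanish. *)
Lemma actA_at_root u f : u != 0 -> q * u ^+ 2 - q^-1 * u ^- 2 != 0 ->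
  (actA (f * ('X - (Z u)%:P))).[Z u]
    = (q - q^-1) * (coefP u * f.[Z (q * u)] - coefM u * f.[Z (q^-1 * u)]).
Proof.
move=> u0 bu; rewrite -/(D u f).
(* Eliminating c puts the constraint b c = bs cs into the rational identities below. *)
have cE : c = bs * cs / b by rewrite -bc; field; exact: b0.
have bu' : q * u ^+ 2 * (q * u ^+ 2) - 1 != 0.
  apply: contraNneq bu => h; apply/eqP.
  have -> : q * u ^+ 2 - q^-1 * u ^- 2 = (q * u ^+ 2 * (q * u ^+ 2) - 1) / (q * u ^+ 2).
    by field; rewrite q0 u0.
  by rewrite h mul0r.
(* The two initial values that determine the solution of the recurrence [D_rec]. *)
have D1 : D u 1 = (q - q^-1) * (coefP u - coefM u).
  rewrite DE actA_1 actS_1 /actA1 /actS1 !hornerE /= /kap /gA /beta /coefP /coefM /zt /Zfun cE.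
  by field; rewrite q0 t0 b0 z0 u0 bu'.
have DX : D u 'X = (q - q^-1) * (coefP u * Z (q * u) - coefM u * Z (q^-1 * u)).
  rewrite -[X in D u X]mul1r DE actAX actSX actA_1 actS_1 /actA1 /actS1 !hornerE /=.
  rewrite /kap /gA /gS /beta /coefP /coefM /zt /Zfun cE.
  by field; rewrite q0 t0 b0 z0 u0 bu'.
suff [] : D u f = (q - q^-1) * (coefP u * f.[Z (q * u)] - coefM u * f.[Z (q^-1 * u)]) /\
  D u (f * 'X) = (q - q^-1) * (coefP u * Z (q * u) * f.[Z (q * u)]
                    - coefM u * Z (q^-1 * u) * f.[Z (q^-1 * u)]) by [].
elim/poly_ind: f => [|f x [IH0 IH1]].
  by rewrite mul0r !horner0 !mulr0 subr0 mulr0 DE actA0 actS0 !horner0 !mulr0 !addr0.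
have -> : f * 'X + x%:P = x *: 1 + f * 'X by rewrite addrC alg_polyC.
have -> : (x *: 1 + f * 'X) * 'X = x *: 'X + f * 'X * 'X by rewrite -!mul_polyC; ring.
rewrite !D_lin D_rec // IH0 IH1 D1 DX !hornerE /=.
move: (coefP u) (coefM u) f.[_] f.[_] => x1 x2 x3 x4; rewrite /Zfun.
by split; field; rewrite q0 u0.
Qed.

(** The zeros, in the variable Z(u), of the product in the inhomogeneous term: for t = q^n that
    product is [zpoly n.+1] at Z(u). *)
Definition zroot (k : nat) : F := q ^+ k ^+ 2 / t * z ^+ 2 + q ^+ k ^- 2 * t * z ^- 2.

Definition zpoly (k : nat) : {poly F} := \prod_(i < k) ('X - (zroot i)%:P).

(* The coefficient phi makes the Askey-Wilson operator bidiagonal on the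
   Newton basis [zpoly k]; it vanishes for Q = q t, which truncates the basis. *)
Let phi (Q : F) : F :=
  (Q - Q^-1) * (Q / (q * t) - q * t / Q)
   * (b * t + c / t + cs * q / Q ^+ 2 / z ^+ 2 + bs * Q ^+ 2 * z ^+ 2 / q).

(** The induction step for the Newton basis, with w', w, w1, w2 standing for [zpoly] at k-1, k, k+1,
    k+2. The relation w' 'X = w + v w' is assumed only after multiplication by A0 or S0: it fails
    for k = 0, where [k.-1] is 0, but there both coefficients vanish. *)
Let act_step (w' w w1 w2 : {poly F}) (A0 A1 A2 S0 S1 x y v : F) :
  actA w = A2 *: w1 + A1 *: w + A0 *: w' -> actS w = S1 *: w + S0 *: w' ->
  w1 = w * ('X - x%:P) -> w2 = w1 * ('X - y%:P) ->
  A0 *: (w' * 'X) = A0 *: w + (A0 * v) *: w' ->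
  S0 *: (w' * 'X) = S0 *: w + (S0 * v) *: w' ->
  actA w1 = (q ^+ 2 * A2) *: w2
    + (q ^+ 2 * A2 * y + q ^+ 2 * A1 - x * A2) *: w1
    + (q ^+ 2 * A1 * x + q ^+ 2 * A0 + q * kap q * S1 + q * gA q t b c bs cs z - x * A1) *: w
    + (q ^+ 2 * A0 * v + q * kap q * S0 - x * A0) *: w'
  /\ actS w1 = (q ^- 2 * S1 - q^-1 * kap q * A2) *: w1
    + (q ^- 2 * S1 * x + q ^- 2 * S0 - q^-1 * kap q * A1 - q^-1 * gS q t b c bs cs z - x * S1) *: w
    + (q ^- 2 * S0 * v - q^-1 * kap q * A0 - x * S0) *: w'.
Proof.
move=> EA ES E1 E2 hA hS; rewrite E1 actA_X_sub actS_X_sub actAX actSX EA ES -E1.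
rewrite !mulrDl -!scalerAl hA hS.
have -> : w1 * 'X = w2 + y *: w1 by rewrite E2 -mul_polyC; ring.
have -> : w * 'X = w1 + x *: w by rewrite E1 -mul_polyC; ring.
by rewrite -!mul_polyC !(polyCD, polyCB, polyCM); split; ring.
Qed.

(** S is bidiagonal on the Newton basis with diagonal entries theta^*_k. The tridiagonal form of T
    is carried along because the recursion of S involves it; in the step, the coefficients of
    [zpoly k.-1] cancel. *)
Lemma act_zpoly k : let Q := q ^+ k in
  actA (zpoly k) = (q * Q ^+ 2 * bs) *: zpoly k.+1
    + (Q ^+ 2 * (b + c * t ^- 2 - bs * z ^+ 2 * (q * t + (q * t)^-1))
       + bs * z ^+ 2 * t^-1 * (q + q^-1) * Q ^+ 4) *: zpoly k
    + (phi Q * (Q ^+ 2 / (q * t) * z ^+ 2)) *: zpoly k.-1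
  /\ actS (zpoly k) = (bs * Q ^+ 2 + cs / Q ^+ 2) *: zpoly k + phi Q *: zpoly k.-1.
Proof.
have zS i : zpoly i.+1 = zpoly i * ('X - (zroot i)%:P) by rewrite /zpoly big_ord_recr.
elim: k => [|k IH] /=.
  have -> : phi (q ^+ 0) = 0 by rewrite /phi expr0 invr1 subrr !mul0r.
  rewrite zS /zpoly !big_ord0 actA_1 actS_1 /actA1 /actS1 /zroot !expr0 !mul0r !scale0r !addr0.
  split; rewrite -!mul_polyC; last by rewrite mulr1 expr1n !mulr1 invr1 mulr1.
  rewrite mul1r mulr1 mulrBr -polyCM -addrA -polyCN -polyCD.
  congr (_ + _); first by rewrite expr1n mulr1.
  by congr (_%:P); rewrite /beta /zt; field; rewrite q0 t0 z0 oner_neq0.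
set Q := q ^+ k in IH *; have Q0 : Q != 0 by rewrite expf_neq0.
have Xz i : zpoly i * 'X = zpoly i.+1 + zroot i *: zpoly i.
  by rewrite zS mulrBr mulrC -mul_polyC; ring.
have phi0 : k = 0%N -> phi Q = 0.
  by move=> k0; rewrite /Q /phi k0 expr0 invr1 subrr !mul0r.
have phiX : phi Q *: (zpoly k.-1 * 'X) = phi Q *: (zpoly k + zroot k.-1 *: zpoly k.-1).
  have [k0|k1] := posnP k; first by rewrite phi0 // !scale0r.
  by rewrite Xz prednK.
(* This is [zroot k.-1] in terms of Q when k > 0; for k = 0 it only occurs multiplied by phi Q =
   0. *)
pose v := Q ^+ 2 / q ^+ 2 / t * z ^+ 2 + q ^+ 2 / Q ^+ 2 * t * z ^- 2.
have phz : phi Q * zroot k.-1 = phi Q * v.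
  have [k0|k1] := posnP k; first by rewrite phi0 // !mul0r.
  have QE : Q = q * q ^+ k.-1 by rewrite /Q -exprS prednK.
  rewrite /zroot /v QE; congr (_ * _); field; by rewrite q0 t0 z0 expf_neq0.
have zk1 : zroot k.+1 = q ^+ 2 * Q ^+ 2 / t * z ^+ 2 + t / (q ^+ 2 * Q ^+ 2) * z ^- 2.
  rewrite /zroot (exprS q k) -/Q; field; by rewrite q0 t0 z0 Q0.
have zk : zroot k = Q ^+ 2 / t * z ^+ 2 + Q ^- 2 * t * z ^- 2 by [].
have [EA ES] := IH.
have hS : phi Q *: (zpoly k.-1 * 'X) = phi Q *: zpoly k + (phi Q * v) *: zpoly k.-1.
  by rewrite phiX scalerDr scalerA phz.
have hA m : (phi Q * m) *: (zpoly k.-1 * 'X) = (phi Q * m) *: zpoly k + (phi Q * m * v) *: zpoly k.-1.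
  have sE (w : {poly F}) : (phi Q * m) *: w = m *: (phi Q *: w) by rewrite scalerA mulrC.
  by rewrite !sE hS scalerDr !scalerA; congr (_ + _ *: _); ring.
have [-> ->] := act_step EA ES (zS k) (zS k.+1) (hA _) hS.
have cE : c = bs * cs / b by rewrite -bc; field; exact: b0.
rewrite (exprS q k) -/Q zk zk1.
have QQ := Q0; split.
  rewrite -[RHS]addr0; congr (_ *: _ + _ *: _ + _ *: _ + _).
  - by ring.
  - by field; rewrite q0 t0 z0 Q0.
  - rewrite /phi /kap /gA /zt; field; by rewrite q0 t0 z0 Q0.
  - by rewrite [X in X *: _](_ : _ = 0) ?scale0r //; rewrite /phi /kap /v; field; rewrite q0 t0 z0 Q0.
rewrite -[RHS]addr0; congr (_ *: _ + _ *: _ + _).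
- by rewrite /kap; field; rewrite q0 Q0.
- rewrite /phi /kap /gS /zt; field; by rewrite q0 t0 z0 Q0.
- by rewrite [X in X *: _](_ : _ = 0) ?scale0r //; rewrite /phi /kap /v; field; rewrite q0 t0 z0 Q0.
Qed.

(** At Q = q^(n+1) = q t the off-diagonal coefficient phi vanishes, leaving an eigenpolynomial of S
    for theta^*_{n+1}. *)
Lemma actS_zpoly_top n : t = q ^+ n ->
  actS (zpoly n.+1) = (bs * (q * t) ^+ 2 + cs / (q * t) ^+ 2) *: zpoly n.+1.
Proof.
move=> tE; have [_ ->] := act_zpoly n.+1.
rewrite (exprS q n) -tE [X in _ + X](_ : _ = 0) ?addr0 // /phi.
by rewrite divff ?mulf_neq0 // subrr mulr0 !mul0r scale0r.
Qed.

End Evaluation.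

(** * Top coefficients and the Bethe polynomial *)

Lemma prod_XsubC_top (F : fieldType) m (x : 'I_m -> F) :
  let f := \prod_(i < m) ('X - (x i)%:P) in
  [/\ size f = m.+1, f`_m = 1 & (0 < m)%:R * f`_m.-1 = - \sum_(i < m) x i].
Proof.
have sP k (y : 'I_k -> F) : size (\prod_(i < k) ('X - (y i)%:P)) = k.+1.
  by rewrite -big_enum size_prod_XsubC size_enum_ord.
have f1 k (y : 'I_k -> F) : (\prod_(i < k) ('X - (y i)%:P))`_k = 1.
  have /monicP := monic_prod_XsubC (index_enum 'I_k) xpredT y.
  by rewrite lead_coefE sP.
rewrite /= sP f1; split=> //; elim: m x => [|m IH] x.
  by rewrite !big_ord0 mul0r oppr0.
rewrite !big_ord_recr /= mul1r mulrBr coefB coefMX coefMC f1 mul1r opprD.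
congr (_ - _); rewrite -IH; case: m x {IH} => [|m] x //=; by rewrite ?mul0r ?mul1r.
Qed.

(** Two geometric sums. Up to sign, the sum is the subleading coefficient of [zpoly m.+1], which
    enters the eigenvalue. *)
Lemma sum_zroot (F : fieldType) (q t z : F) m : q != 0 -> t != 0 -> z != 0 ->
  t = q ^+ m ->
  (q - q^-1) * \sum_(k < m.+1) zroot q t z k = zt z * (q * t - (q * t)^-1).
Proof.
move=> q0 t0 z0 tE.
have H k : (q - q^-1) * \sum_(i < k) zroot q t z i =
   (q ^+ k ^+ 2 - 1) / q / t * z ^+ 2 + (1 - q ^+ k ^- 2) * q * t * z ^- 2.
  elim: k => [|k IH]; first by rewrite big_ord0 expr0 expr1n invr1 !subrr; ring.
  rewrite big_ord_recr /= mulrDr IH /zroot (exprS q k).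
  have := expf_neq0 k q0; move: (q ^+ k) => Q Q0.
  by field; rewrite q0 t0 z0 Q0.
by rewrite H (exprS q m) -tE /zt; field; rewrite q0 t0 z0.
Qed.

Section BethePolynomial.

Context {F : fieldType}.
Variables q t b c bs cs z : F.
Hypotheses (q0 : q != 0) (t0 : t != 0) (b0 : b != 0) (z0 : z != 0).
Hypothesis (bc : b * c = bs * cs).

Lemma actA_bethe n (y : 'I_n -> F) :
  let f := \prod_(i < n) ('X - (Zfun q (y i))%:P) in
  t = q ^+ n -> injective (fun i => Zfun q (y i)) ->
  (forall i, y i != 0) -> (forall i, q * y i ^+ 2 - q^-1 * y i ^- 2 != 0) ->
  (forall i, (q - q^-1) *
     (coefP q t b bs cs z (y i) * \prod_(j < n | j != i) (Zfun q (q * y i) - Zfun q (y j))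
      - coefM q t b bs cs z (y i) * \prod_(j < n | j != i) (Zfun q (q^-1 * y i) - Zfun q (y j)))
     = q * t ^+ 2 * bs * (zpoly q t z n.+1).[Zfun q (y i)]) ->
  actA q t b c bs cs z f = (q * t ^+ 2 * bs) *: zpoly q t z n.+1
    + (t ^+ 2 * (beta q t b c bs z - q^-1 * bs * \sum_i Zfun q (y i))
       + q * t ^+ 2 * bs * \sum_(k < n.+1) zroot q t z k) *: f.
Proof.
move=> f tE Zinj y0 by0 bethe.
have [sf fn fn1] := prod_XsubC_top (fun i => Zfun q (y i)); rewrite -/f in sf fn fn1.
have [sw wn wn1] := prod_XsubC_top (fun i : 'I_n.+1 => zroot q t z i).
rewrite -/(zpoly q t z n.+1) mul1r /= in sw wn wn1.
have [sA _ cA1 cA0] := act_top t b c bs cs z q0 (eq_leq sf).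
rewrite -tE fn in cA1 cA0.
set mu := _ + q * _ * _ * _; apply/eqP; rewrite -subr_eq0; apply/eqP.
set r := _ - _.
apply: (@roots_geq_poly_eq0 _ _ [seq Zfun q (y i) | i <- enum 'I_n]).
- apply/allP => x /mapP[i _ ->]; rewrite /root /r.
  have fE : f = \prod_(j < n | j != i) ('X - (Zfun q (y j))%:P) * ('X - (Zfun q (y i))%:P).
    by rewrite /f (bigD1 i) //= mulrC.
  have f0 : f.[Zfun q (y i)] = 0 by rewrite fE !hornerE subrr mulr0.
  have hp x0 : (\prod_(j < n | j != i) ('X - (Zfun q (y j))%:P)).[x0]
      = \prod_(j < n | j != i) (x0 - Zfun q (y j)).
    by rewrite horner_prod; apply: eq_bigr => j _; rewrite hornerXsubC.
  rewrite hornerD hornerN hornerD !hornerZ f0 [X in actA _ _ _ _ _ _ _ X]fE.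
  by rewrite (actA_at_root q0 t0 b0 z0 bc) // !hp bethe mulr0 addr0 subrr.
- by rewrite map_inj_uniq ?enum_uniq.
rewrite size_map size_enum_ord.
(* The coefficient of degree n vanishes by the choice of mu, that of degree n+1 because [zpoly n.+1]
   is monic and q t^2 bs is the leading coefficient of T f; higher degrees do not occur. *)
apply/leq_sizeP => j; rewrite leq_eqVlt => /predU1P[<-|].
  rewrite /r !coefE cA0 fn wn1 /mu.
  have -> : (0 < n)%:R * q^-1 * bs * f`_n.-1 = q^-1 * bs * ((0 < n)%:R * f`_n.-1) by ring.
  by rewrite fn1; ring.
rewrite leq_eqVlt => /predU1P[<-|nj].
  by rewrite /r !coefE cA1 wn (nth_default _ (eq_leq sf)); ring.
rewrite /r !coefE !nth_default ?sf ?sw //; first by rewrite !mulr0 addr0 subrr.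
- exact: ltnW.
- exact: leq_trans sA _.
Qed.

End BethePolynomial.

(** * Realization of T and S on row vectors *)

Section RowAction.

Context {F : fieldType} {n : nat}.
Variables q t b c bs cs z : F.
Variables (A S W : 'M[F]_n.+1) (e : 'rV[F]_n.+1).
Hypothesis WA : W *m A = q ^+ 2 *: (A *m W) + (q * kap q) *: S + (q * gA q t b c bs cs z)%:M.
Hypothesis WS : W *m S = q ^- 2 *: (S *m W) - (q^-1 * kap q) *: A - (q^-1 * gS q t b c bs cs z)%:M.
Hypothesis eA : e *m A = (q * bs) *: (e *m W) + beta q t b c bs z *: e.
Hypothesis eS : e *m S = (bs + cs) *: e.

Lemma row_act f :
  e *m horner_mx W f *m A = e *m horner_mx W (actA q t b c bs cs z f) /\
  e *m horner_mx W f *m S = e *m horner_mx W (actS q t b c bs cs z f).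
Proof.
elim/poly_ind: f => [|f x [IHA IHS]].
  by rewrite actA0 actS0 !rmorph0 mulmx0 !mul0mx.
rewrite actA_cons actS_cons !(rmorphD, rmorphB) /= !linearZ /= !rmorphM /= /actA1 /actS1.
rewrite !rmorphD /= !linearZ /= !horner_mx_C !horner_mx_X.
rewrite -![horner_mx W _ * W]/(horner_mx W _ *m W).
rewrite !(mulmxDr, mulmxDl, mulmxBr) -!scalemxAr !mul_mx_scalar.
rewrite !mulmxDr !mul_mx_scalar -!scalemxAr.
rewrite !mulmxA -IHA -IHS -!scalemxAl eA eS -!(mulmxA _ W) WA WS.
rewrite !(mulmxDr, mulmxBr) !mul_mx_scalar -!scalemxAr !mulmxA.
split; rewrite addrC; congr (_ + _).
- by rewrite /beta !scalerDl ?scaleNr.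
- by rewrite scalerDl.
by rewrite !rmorphN !mulmxN -scalemxAr mul_mx_scalar !scalerN -IHA.
Qed.

(** The row would be a left eigenvector of S for theta^*_{n+1}, which the last hypothesis rules
    out. *)
Lemma row_annihilate : q != 0 -> t != 0 -> b != 0 -> z != 0 -> b * c = bs * cs ->
  t = q ^+ n ->
  (forall v : 'rV_n.+1, v *m S = (bs * (q * t) ^+ 2 + cs / (q * t) ^+ 2) *: v -> v = 0) ->
  e *m horner_mx W (zpoly q t z n.+1) = 0.
Proof.
move=> q0 t0 b0 z0 bc tE H; apply: H.
have [_ ->] := row_act (zpoly q t z n.+1).
by rewrite (actS_zpoly_top q0 t0 b0 z0 bc tE) linearZ /= -scalemxAr.
Qed.

End RowAction.

(** * The matrix W of a tridiagonal pair *)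

(** Each factor W - x extends the support of the row by at most one place to the right, and m steps
    lead from 0 to m only through the superdiagonal entries; the shifts x do not enter. *)
Lemma hessenberg_row (F : fieldType) n (W : 'M[F]_n.+1) (m : nat) (x : 'I_m -> F) :
  (forall i j : 'I_n.+1, (i.+1 < j)%N -> W i j = 0) -> (m <= n)%N ->
  let r := delta_mx 0 ord0 *m horner_mx W (\prod_(i < m) ('X - (x i)%:P)) : 'rV_n.+1 in
  (forall j : 'I_n.+1, (m < j)%N -> r 0 j = 0) /\
  r 0 (inord m) = \prod_(i < m) W (inord i) (inord i.+1).
Proof.
move=> Wh; elim: m x => [|m IH] x mn r.
  rewrite /r !big_ord0 rmorph1 mulmx1; split=> [j j0|]; rewrite mxE eqxx /=.
    by rewrite -val_eqE /= gtn_eqF.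
  by rewrite -val_eqE /= inordK.
pose x' i := x (widen_ord (leqnSn m) i); pose xm := x ord_max.
pose r1 : 'rV_n.+1 := delta_mx 0 ord0 *m horner_mx W (\prod_(i < m) ('X - (x' i)%:P)).
have [r0 rm] := IH x' (ltnW mn); rewrite -/r1 in r0 rm.
have rS : r = r1 *m W - xm *: r1.
  rewrite /r big_ord_recr rmorphM rmorphB /= horner_mx_X horner_mx_C.
  by rewrite -mulmxE mulmxA mulmxBr mul_mx_scalar.
rewrite rS; clear rS r; clearbody r1; split=> [j mj|].
  rewrite !mxE (r0 _ (ltnW mj)) mulr0 subr0 big1 // => k _.
  have [km|mk] := leqP k m; last by rewrite r0 ?mul0r.
  by rewrite Wh ?mulr0 //; apply: leq_ltn_trans mj.
rewrite !mxE (r0 (inord m.+1)) ?inordK // mulr0 subr0.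
rewrite (bigD1 (inord m)) //= rm [X in _ + X]big1 ?addr0 => [|k km].
  by rewrite big_ord_recr.
have {}km : k != m :> nat by apply: contraNneq km => <-; rewrite inord_val.
have [mk|mk] := ltnP m k; first by rewrite r0 ?mul0r.
rewrite Wh ?mulr0 // inordK //; lia.
Qed.

Section TridiagonalPair.

Context {F : fieldType} {n : nat}.
Variables q b c bs cs z : F.
Hypothesis qnru : not_root_of_unity q.
Hypotheses (b0 : b != 0) (c0 : c != 0) (bs0 : bs != 0) (cs0 : cs != 0) (z0 : z != 0).
Hypothesis (bc : b * c = bs * cs).
Variable (A : 'M[F]_n.+1).

Local Notation t := (q ^+ n).

Definition dual_ev (k : nat) : F := bs * q ^+ k ^+ 2 + cs / q ^+ k ^+ 2.
Let S : 'M[F]_n.+1 := diag_mx (\row_i dual_ev i).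

Definition aw_rho : F := - (b * c * (q ^+ 2 - q ^- 2) ^+ 2).
Definition aw_omega : F := (q - q^-1) ^+ 2 * (b * c * zt z * (q * t + (q * t)^-1)
     - (b * t + c / t) * (bs * t + cs / t)).
Definition aw_eta : F := - ((q ^+ 2 - q ^- 2) ^+ 2 / (q + q^-1) * (b * c) *
     ((b * t + c / t) * zt z - (bs * t + cs / t) * (q * t + (q * t)^-1))).
Definition aw_eta_star : F := - ((q ^+ 2 - q ^- 2) ^+ 2 / (q + q^-1) * (bs * cs) *
     ((bs * t + cs / t) * zt z - (b * t + c / t) * (q * t + (q * t)^-1))).

(** The prefactor is -(q^2 - q^-2) / rho. *)
Definition Wmx : 'M[F]_n.+1 := (b * c * (q ^+ 2 - q ^- 2))^-1 *:
  (q *: (S *m A) - q^-1 *: (A *m S) + (aw_omega / (q - q^-1))%:M).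

Hypothesis R1 : A *m A *m S = (q ^+ 2 + q ^- 2) *: (A *m S *m A) - S *m A *m A
  + (aw_rho *: S + aw_omega *: A + aw_eta%:M).
Hypothesis R2 : S *m S *m A = (q ^+ 2 + q ^- 2) *: (S *m A *m S) - A *m S *m S
  + (aw_rho *: A + aw_omega *: S + aw_eta_star%:M).

Lemma nru_neq0 : [/\ q != 0, q - q^-1 != 0, q + q^-1 != 0 & q ^+ 2 - q ^- 2 != 0].
Proof.
have [q0 qk] := qnru.
have e4 : q ^+ 2 - q ^- 2 = (q ^+ 4 - 1) / q ^+ 2 by field.
have n4 : q ^+ 2 - q ^- 2 != 0.
  by rewrite e4 mulf_neq0 ?invr_eq0 ?expf_neq0 // subr_eq0 qk.
have : q ^+ 2 - q ^- 2 = (q - q^-1) * (q + q^-1) by field.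
by move=> e; move: n4; rewrite {1}e mulf_eq0 negb_or => /andP[h1 h2]; split; rewrite // e mulf_neq0.
Qed.

Let den1 : q * q - 1 != 0.
Proof. by have [_ /(_ 2%N isT)] := qnru; rewrite subr_eq0 expr2. Qed.

Let den2 : q * q + 1 != 0.
Proof.
have [_ /(_ 4%N isT)] := qnru; apply: contraNneq => h.
have e : q ^+ 4 - 1 = (q * q + 1) * (q * q - 1) by ring.
by rewrite -subr_eq0 e h mul0r.
Qed.

Let den4 : q ^+ 2 * q ^+ 2 - 1 != 0.
Proof. by have [_ /(_ 4%N isT)] := qnru; rewrite subr_eq0 -exprD. Qed.

Lemma W_A : Wmx *m A = q ^+ 2 *: (A *m Wmx) + (q * kap q) *: S + (q * gA q t b c bs cs z)%:M.
Proof.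
have [q0 _ _ _] := nru_neq0; have t0 : t != 0 by rewrite expf_neq0.
rewrite /Wmx -!scalemxAl -!scalemxAr !(mulmxDl, mulmxDr) !mulNmx !mulmxN.
rewrite -!scalemxAl -!scalemxAr !mul_mx_scalar !mul_scalar_mx !mulmxA R1.
(* Once [R1] has eliminated A A S, the identity is linear in the remaining words and can be checked
   entrywise. *)
move: (S *m A *m A) (A *m S *m A) => X1 X2; move: S A => S' A'.
apply/matrixP => i j; rewrite !mxE /gA /kap /aw_rho /aw_omega /aw_eta.
move: (X1 i j) (X2 i j) (S' i j) (A' i j) (q ^+ n) t0 => x1 x2 s a u u0.
case: (i == j); rewrite ?mulr1n ?mulr0n; field.
all: by rewrite ?q0 ?b0 ?c0 ?u0 ?den1 ?den2 ?den4.
Qed.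

Lemma W_S : Wmx *m S = q ^- 2 *: (S *m Wmx) - (q^-1 * kap q) *: A
  - (q^-1 * gS q t b c bs cs z)%:M.
Proof.
have [q0 _ _ _] := nru_neq0; have t0 : t != 0 by rewrite expf_neq0.
rewrite /Wmx -!scalemxAl -!scalemxAr !(mulmxDl, mulmxDr) !mulNmx !mulmxN.
rewrite -!scalemxAl -!scalemxAr !mul_mx_scalar !mul_scalar_mx !mulmxA R2.
move: (S *m A *m S) (A *m S *m S) => X1 X2; move: S A => S' A'.
apply/matrixP => i j; rewrite !mxE /gS /kap /aw_rho /aw_omega /aw_eta_star -bc.
move: (X1 i j) (X2 i j) (S' i j) (A' i j) (q ^+ n) t0 => x1 x2 s a u u0.
case: (i == j); rewrite ?mulr1n ?mulr0n; field.
all: by rewrite ?q0 ?b0 ?c0 ?u0 ?den1 ?den2 ?den4.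
Qed.

Lemma Wmx_entry i j : Wmx i j = (b * c * (q ^+ 2 - q ^- 2))^-1 *
  ((q * dual_ev i - q^-1 * dual_ev j) * A i j + (aw_omega / (q - q^-1)) *+ (i == j)).
Proof.
rewrite /Wmx mul_diag_mx mul_mx_diag !mxE; congr (_ * (_ + _)); ring.
Qed.

(** Serves both ends of the chain: reversing the order of the theta^*_N replaces (bs, cs) by (cs /
    t^2, bs t^2), which preserves bs cs and bs t + cs / t. An end has one neighbour, where the
    entries of A and q bs' W agree; the diagonal entry then fixes the constant. *)
Lemma end_row (i0 : 'I_n.+1) (bs' cs' : F) :
  cs' != 0 -> bs' * cs' = b * c -> bs' * t + cs' / t = bs * t + cs / t ->
  dual_ev i0 = bs' + cs' ->
  (forall j, j != i0 -> A i0 j = 0 \/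
      q * (bs' + cs') - q^-1 * dual_ev j = cs' * q^-1 * (q ^+ 2 - q ^- 2)) ->
  A i0 i0 * (cs' - q ^+ 2 * bs') = (b + c) * (cs' - q ^+ 2 * bs')
    - (1 - t ^- 2) * (c * cs' + b * bs' * q ^+ 2 * t ^+ 2 + q * t * b * c * zt z) ->
  delta_mx 0 i0 *m A = (q * bs') *: (delta_mx 0 i0 *m Wmx)
     + beta q t b c bs' z *: (delta_mx 0 i0 : 'rV_n.+1).
Proof.
move=> cs'0 e1 e2 e3 Aj Ai; have [q0 _ _ _] := nru_neq0; have t0 : t != 0 by rewrite expf_neq0.
rewrite -!rowE; apply/rowP => j; rewrite 2!mxE [X in _ = X + _]mxE [X in _ = _ * X + _]mxE.
rewrite [X in _ = _ + X]mxE [X in _ = _ + _ * X]mxE eqxx /= Wmx_entry e3 eq_sym.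
have bs'0 : bs' != 0.
  by apply: contraNneq b0 => h; move/eqP: e1; rewrite h mul0r eq_sym mulf_eq0 (negPf c0) orbF.
rewrite -e1; case: eqVneq => [->|ji]; last first.
  rewrite mulr0n addr0 mulr0 addr0.
  have [->|->] := Aj _ ji; first by rewrite !mulr0.
  by field; rewrite q0 bs'0 cs'0 den4.
rewrite e3 mulr1n mulr1; apply/eqP; rewrite -subr_eq0; apply/eqP.
set L := (X in X = 0).
have -> : L = (A i0 i0 * (cs' - q ^+ 2 * bs') - ((b + c) * (cs' - q ^+ 2 * bs')
    - (1 - t ^- 2) * (c * cs' + b * bs' * q ^+ 2 * t ^+ 2 + q * t * b * c * zt z)))
      / (cs' * (q ^+ 2 + 1)).
  have cE : c = bs' * cs' / b by rewrite e1; field; exact: b0.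
  rewrite /L /aw_omega -e2 /beta cE; move: (q ^+ n) t0 => u u0.
  by field; rewrite q0 bs'0 cs'0 b0 u0 ?den4 ?den1 ?den2.
by rewrite Ai subrr mul0r.
Qed.

Hypothesis generic : forall k, (k <= 2 * n)%N -> cs - bs * q ^+ (2 * k) != 0.
Hypothesis Atri : forall i j : 'I_n.+1, (i.+1 < j)%N || (j.+1 < i)%N -> A i j = 0.
Hypothesis Alow : forall i j : 'I_n.+1, i = j.+1 :> nat -> A i j != 0.
Hypothesis A_first : A ord0 ord0 * (cs - q ^+ 2 * bs) = (b + c) * (cs - q ^+ 2 * bs)
    - (1 - t ^- 2) * (c * cs + b * bs * q ^+ 2 * t ^+ 2 + q * t * b * c * zt z).
Hypothesis A_last :
  A ord_max ord_max * (bs * t ^+ 2 - q ^+ 2 * (cs / t ^+ 2))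
    = (b + c) * (bs * t ^+ 2 - q ^+ 2 * (cs / t ^+ 2))
    - (1 - t ^- 2) * (c * (bs * t ^+ 2) + b * (cs / t ^+ 2) * q ^+ 2 * t ^+ 2
        + q * t * b * c * zt z).

Lemma first_row : delta_mx 0 ord0 *m A = (q * bs) *: (delta_mx 0 ord0 *m Wmx)
     + beta q t b c bs z *: (delta_mx 0 ord0 : 'rV_n.+1).
Proof.
have [q0 _ _ _] := nru_neq0.
apply: (@end_row ord0 bs cs) => //; first by rewrite /dual_ev expr0 expr1n mulr1 divr1.
move=> j; rewrite -val_eqE /= => j0; have [j1|j1] := ltnP 1 j.
  by left; rewrite Atri //= j1.
right; have -> : j = 1%N :> nat by move: j0 j1; clear; lia.
by rewrite /dual_ev; field.
Qed.

Lemma last_row : delta_mx 0 ord_max *m A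
   = (q * (cs / t ^+ 2)) *: (delta_mx 0 ord_max *m Wmx)
     + beta q t b c (cs / t ^+ 2) z *: (delta_mx 0 ord_max : 'rV_n.+1).
Proof.
have [q0 _ _ _] := nru_neq0; have t0 : t != 0 by rewrite expf_neq0.
apply: (@end_row ord_max (cs / t ^+ 2) (bs * t ^+ 2)) => //.
- by rewrite mulf_neq0 ?expf_neq0.
- by rewrite bc; field.
- by field.
- by rewrite /dual_ev /= addrC.
move=> j; rewrite -val_eqE /= => jn; have jlt := ltn_ord j.
have [j1|j1] := ltnP j.+1 n; first by left; rewrite Atri //= j1 orbT.
right; have tE : t = q * q ^+ j by rewrite -exprS; congr (_ ^+ _); move: jn jlt j1; clear; lia.
rewrite /dual_ev tE; move: (q ^+ j) (expf_neq0 j q0) => Q Q0.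
by field; rewrite q0 Q0.
Qed.

Let evS (v : 'rV_n.+1) (x : F) : (forall i : 'I_n.+1, dual_ev i != x) ->
  v *m S = x *: v -> v = 0.
Proof.
move=> h /rowP E; apply/rowP => i; have := E i.
rewrite mul_mx_diag !mxE mulrC => /eqP; rewrite -subr_eq0 -mulrBl mulf_eq0 subr_eq0.
by rewrite (negPf (h i)) => /eqP.
Qed.

Let eSrow (i : 'I_n.+1) : delta_mx 0 i *m S = dual_ev i *: (delta_mx 0 i : 'rV_n.+1).
Proof.
rewrite -rowE; apply/rowP => j; rewrite !mxE [j == i]eq_sym.
by case: eqVneq => [->|_]; rewrite ?mulr1 ?mulr0.
Qed.

Let expq_inj i j : q ^+ i = q ^+ j -> i = j.
Proof.
have [q0 qk] := qnru.
wlog ij : i j / (i <= j)%N => [H|].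
  by have [/H//|/ltnW/H H' /esym/H'] := leqP i j.
move=> e; apply/eqP; rewrite eqn_leq ij /= leqNgt; apply/negP => ji.
have ij0 : (0 < j - i)%N by rewrite subn_gt0.
by have /eqP[] := qk _ ij0; rewrite expfB // e divff // expf_neq0.
Qed.

Let dual_ev_diff i j : dual_ev i - dual_ev j =
  (q ^+ (2 * i) - q ^+ (2 * j)) * (bs - cs / q ^+ (2 * (i + j))).
Proof.
have [q0 _ _ _] := nru_neq0; rewrite /dual_ev mulnDr exprD !(mulnC 2) !exprM.
move: (q ^+ i) (q ^+ j) (expf_neq0 i q0) (expf_neq0 j q0) => x y x0 y0.
by field; rewrite x0 y0.
Qed.

(* e chi(W) is a left eigenvector of A^* for theta^*_{n+1}, which is not an
   eigenvalue unless theta^*_{n+1} = theta^*_n.  In that case the same argument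
   is applied to the last basis vector, where theta^*_{-1} is not an eigenvalue,
   and the result is carried back to the first one through the nonzero
   subdiagonal entries of W. *)
Lemma zpoly_row0 : delta_mx 0 ord0 *m horner_mx Wmx (zpoly q t z n.+1) = 0 :> 'rV_n.+1.
Proof.
have [q0 _ _ _] := nru_neq0; have t0 : t != 0 by rewrite expf_neq0.
have [cE|cN] := eqVneq cs (bs * q ^+ (2 * (n + n.+1))); last first.
  have eS : delta_mx 0 ord0 *m S = (bs + cs) *: (delta_mx 0 ord0 : 'rV_n.+1).
    by rewrite eSrow /dual_ev /= expr0 expr1n mulr1 divr1.
  apply: (row_annihilate W_A W_S first_row eS q0 t0 b0 z0 bc erefl) => v.
  (* theta^*_i = theta^*_{n+1} would force cs = bs q^(2(i+n+1)), excluded by genericity for i < n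
     and by [cN] for i = n. *)
  rewrite -exprS; apply: evS => i; rewrite -subr_eq0 dual_ev_diff mulf_neq0 //.
    rewrite subr_eq0; apply/eqP => /expq_inj; have := ltn_ord i; clear; lia.
  rewrite subr_eq0; apply/eqP => /eqP; rewrite eq_sym; apply/negP.
  have Q0 k : q ^+ k != 0 by rewrite expf_neq0.
  rewrite -[bs](mulfK (Q0 (2 * (i + n.+1))%N)) (inj_eq (mulIf _)) ?invr_eq0 //.
  have [->//|ni] := eqVneq (i : nat) n.
  by rewrite -subr_eq0 generic //; move: ni (ltn_ord i); clear; lia.
have last0 : delta_mx 0 ord_max *m horner_mx Wmx (zpoly q t z n.+1) = 0 :> 'rV_n.+1.
  have eA := last_row.
  (* The reversal leaves the structure constants unchanged, and [zpoly] does not involve bs and cs,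
     so the row argument applies verbatim at the other end. *)
  have gAE : gA q t b c (cs / t ^+ 2) (bs * t ^+ 2) z = gA q t b c bs cs z.
    by rewrite /gA; move: (q ^+ n) t0 => u u0; field; rewrite q0 u0.
  have gSE : gS q t b c (cs / t ^+ 2) (bs * t ^+ 2) z = gS q t b c bs cs z.
    by rewrite /gS; move: (q ^+ n) t0 => u u0; field; rewrite q0 u0.
  have bc' : b * c = cs / t ^+ 2 * (bs * t ^+ 2).
    by rewrite bc; move: (q ^+ n) t0 => u u0; field.
  have eS : delta_mx 0 ord_max *m S = (cs / t ^+ 2 + bs * t ^+ 2) *: (delta_mx 0 ord_max : 'rV_n.+1).
    by rewrite eSrow /dual_ev /= addrC.
  have WA := W_A; have WS := W_S; rewrite -gAE in WA; rewrite -gSE in WS.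
  apply: (row_annihilate WA WS eA eS q0 t0 b0 z0 bc' erefl) => v.
  apply: evS => i; rewrite -subr_eq0.
  have -> : dual_ev i - (cs / t ^+ 2 * (q * t) ^+ 2 + bs * t ^+ 2 / (q * t) ^+ 2)
     = (q ^+ (2 * i.+1) - 1) * (bs * q ^+ (2 * i) - cs * q ^+ 2) / q ^+ (2 * i.+1).
    rewrite /dual_ev mulnS exprD mulnC exprM; move: (q ^+ i) (expf_neq0 i q0) => x x0.
    by move: (q ^+ n) t0 => u u0; field; rewrite q0 x0 u0.
  rewrite !mulf_neq0 ?invr_eq0 ?expf_neq0 //.
    by rewrite subr_eq0; have [_ ->] := qnru.
  (* theta^*_0 = theta^*_{-1} would give q^(4n+4) = 1 by [cE]; for i > 0 genericity at i-1
     applies. *)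
  case: (nat_of_ord i) (ltn_ord i) => [_|k kn].
    have -> : bs * q ^+ (2 * 0) - cs * q ^+ 2 = - bs * (q ^+ (2 * (n + n.+1) + 2) - 1).
      by rewrite cE exprD; ring.
    rewrite mulf_neq0 ?oppr_eq0 // subr_eq0; have [_ ->] := qnru => //; clear; lia.
  have -> : bs * q ^+ (2 * k.+1) - cs * q ^+ 2 = - q ^+ 2 * (cs - bs * q ^+ (2 * k)).
    by rewrite mulnS exprD; ring.
  rewrite mulf_neq0 ?oppr_eq0 ?expf_neq0 // generic //; move: kn; clear; lia.
set X := horner_mx _ _ in last0 *.
have XC : Wmx *m X = X *m Wmx.
  by rewrite /X; exact: (comm_mx_horner (zpoly q t z n.+1) (comm_mx_refl Wmx)).
(* Descending induction on the row: row i+1 of W X = X W is zero, and in its expansion only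
   W_{i+1,i} times row i of X is left. *)
have rowX : forall k (i : 'I_n.+1), (n - i = k)%N -> row i X = 0.
  elim/ltn_ind => k IH i ik; have [k0|k1] := posnP k.
    have -> : i = ord_max by apply: val_inj => /=; move: k0 ik (ltn_ord i); clear; lia.
    by rewrite rowE last0.
  have iS : (i.+1 < n.+1)%N by move: k1 ik; clear; lia.
  pose i' := Ordinal iS.
  have Wi' : Wmx i' i != 0.
    rewrite Wmx_entry -val_eqE /= gtn_eqF // mulr0n addr0 mulf_neq0 ?invr_eq0 ?mulf_neq0 //.
    - by have [] := nru_neq0.
    - have -> : q * dual_ev i.+1 - q^-1 * dual_ev i
         = bs * q ^+ (2 * i) * (q ^+ 4 - 1) / q.
        rewrite /dual_ev (exprS q i) mulnC exprM; move: (q ^+ i) (expf_neq0 i q0) => x x0.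
        by field; rewrite q0 x0.
      rewrite !mulf_neq0 ?invr_eq0 ?expf_neq0 // subr_eq0; by have [_ ->] := qnru.
    - exact: Alow.
  have : row i' (Wmx *m X) = 0.
    by rewrite XC row_mul (IH (n - i')%N) ?mul0mx //=; move: k1 ik; clear; lia.
  rewrite row_mul mulmx_sum_row (bigD1 i) //= big1 ?addr0 => [|j ji].
    by move/eqP; rewrite mxE scaler_eq0 (negPf Wi') => /eqP.
  have [ij|ij] := ltnP i j.
    by rewrite (IH (n - j)%N) ?scaler0 //; move: ij ik (ltn_ord j); clear; lia.
  rewrite mxE Wmx_entry Atri ?orbT; last first.
    by apply/orP; right; rewrite /= ltnS ltn_neqAle ij andbT.
  rewrite mulr0 -val_eqE /= gtn_eqF ?mulr0n ?addr0 ?mulr0 ?scale0r //; move: ij; clear; lia.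
by rewrite -rowE (rowX (n - (ord0 : 'I_n.+1))%N).
Qed.
End TridiagonalPair.

(** * Bethe equations *)

Lemma exprz2 (F : fieldType) (x : F) (k : nat) : x ^ (2 * k%:Z) = x ^+ k ^+ 2.
Proof. by rewrite (_ : 2 * k%:Z = (k * 2)%N) -?exprnP ?exprM //; lia. Qed.

Lemma exprzN2 (F : fieldType) (x : F) (k : nat) : x ^ (- (2 * k%:Z)) = (x ^+ k ^+ 2)^-1.
Proof. by rewrite -invr_expz exprz2. Qed.

Section ScalarIdentities.

Context {F : fieldType}.
Variables q b c bs cs z : F.
Local Notation p := (AWParam q b c bs cs z).
Local Notation Z := (Zfun q).

Lemma Zfun_sub u v : q != 0 -> u != 0 -> v != 0 ->
  Z u - Z v = bfun (u / v) * bfun (q * u * v).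
Proof. by move=> q0 u0 v0; rewrite /Zfun /bfun; field; rewrite q0 u0 v0. Qed.

(** Written through Z, the products of f and h over the Bethe roots become values of a polynomial at
    Z(u/q) and Z(qu), divided by its value at Z(u). *)
Lemma ffun_betheE u v : q != 0 -> u != 0 -> v != 0 ->
  ffun_bethe q u v = (Z (q^-1 * u) - Z v) / (Z u - Z v).
Proof.
move=> q0 u0 v0; rewrite /ffun_bethe.
have -> : bfun (q * v / u) * bfun (u * v) = - (Z (q^-1 * u) - Z v).
  by rewrite /bfun /Zfun; field; rewrite q0 u0 v0.
have -> : bfun (v / u) * bfun (q * u * v) = - (Z u - Z v).
  by rewrite /bfun /Zfun; field; rewrite q0 u0 v0.
by rewrite invrN mulrNN.
Qed.

Lemma hfun_betheE u v : q != 0 -> u != 0 -> v != 0 ->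
  hfun_bethe q u v = (Z (q * u) - Z v) / (Z u - Z v).
Proof.
move=> q0 u0 v0; rewrite /hfun_bethe.
have -> : bfun (q ^+ 2 * u * v) * bfun (q * u / v) = Z (q * u) - Z v.
  by rewrite /bfun /Zfun; field; rewrite q0 u0 v0.
have -> : bfun (q * u * v) * bfun (u / v) = Z u - Z v.
  by rewrite /bfun /Zfun; field; rewrite q0 u0 v0.
by [].
Qed.

(** Pair index k in the first factor with n-k in the second: b(x) b(y) = xy + (xy)^-1 - x/y - y/x,
    where xy = q u^2 gives Z(u) and x/y = q^(2k-n) z^2 gives [zroot k]. *)
Lemma zpoly_horner n qh u : qh != 0 -> u != 0 -> z != 0 -> q = qh ^+ 2 ->
  \prod_(k < n.+1) (bfun (qh ^ (1 + 2 * k%:Z - n%:Z) * z * u)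
     * bfun (qh ^ (1 + 2 * k%:Z - n%:Z) * z^-1 * u))
  = (zpoly q (q ^+ n) z n.+1).[Z u].
Proof.
move=> qh0 u0 z0 qE; rewrite big_split /=.
rewrite [X in _ * X](reindex_inj rev_ord_inj) /= -big_split horner_prod.
apply: eq_bigr => k _; rewrite hornerXsubC /zroot.
have -> : qh ^ (1 + 2 * k%:Z - n%:Z) = qh * qh ^+ k ^+ 2 / qh ^+ n.
  by rewrite !expfzDr // exprz2 expr1z -exprnN.
have -> : qh ^ (1 + 2 * (n.+1 - k.+1)%N%:Z - n%:Z) = qh * qh ^+ n / qh ^+ k ^+ 2.
  have -> : 1 + 2 * (n.+1 - k.+1)%N%:Z - n%:Z = 1 + n%:Z - 2 * k%:Z :> int.
    by have := ltn_ord k; clear; lia.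
  by rewrite !expfzDr // exprzN2 expr1z.
have q2 m : q ^+ m = qh ^+ m ^+ 2 by rewrite qE -!exprM mulnC.
rewrite !q2 /bfun /Zfun qE /=.
move: (qh ^+ n) (qh ^+ k) (expf_neq0 n qh0) (expf_neq0 k qh0) => t x t0 x0.
by field; rewrite qh0 t0 x0 u0 z0.
Qed.

Lemma Etilde_bethe n qh (y : 'I_n -> F) :
  not_root_of_unity q -> qh ^+ 2 = q -> b != 0 -> z != 0 ->
  dual_bethe_solution p qh true y ->
  [/\ injective (fun i => Z (y i)), forall i, y i != 0,
     forall i, q * y i ^+ 2 - q^-1 * y i ^- 2 != 0
   & forall i, (q - q^-1) *
     (coefP q (q ^+ n) b bs cs z (y i) * \prod_(j < n | j != i) (Z (q * y i) - Z (y j))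
      - coefM q (q ^+ n) b bs cs z (y i) * \prod_(j < n | j != i) (Z (q^-1 * y i) - Z (y j)))
     = q * q ^+ n ^+ 2 * bs * (zpoly q (q ^+ n) z n.+1).[Z (y i)]].
Proof.
move=> nru qhE b0 z0 [ynt yadm ybq E0]; have [q0 qm0 qp0 _] := nru_neq0 nru.
have y0 i : y i != 0 by have [] := ynt i.
have Zinj i j : i != j -> Z (y i) != Z (y j).
  by move=> /yadm; apply: contraNneq => e; rewrite /Yfun -!/(Zfun q _) e.
have Zi : injective (fun i => Z (y i)).
  by move=> i j e; apply/eqP; apply: contraPT (e) => /Zinj /eqP.
have by0 i : q * y i ^+ 2 - q^-1 * y i ^- 2 != 0 by have := ybq i; rewrite /bfun invfM.
split=> // i; have := E0 i; rewrite /Etilde.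
have qh0 : qh != 0 by apply: contraNneq q0 => h; rewrite -qhE h expr0n.
rewrite (zpoly_horner n qh0 (y0 i) z0 (esym qhE)) /sgb /=.
pose D := \prod_(j < n | j != i) (Z (y i) - Z (y j)).
have D0 : D != 0 by apply/prodf_neq0 => j ij; rewrite subr_eq0 Zinj // eq_sym.
have -> : \prod_(j < n | j != i) ffun_bethe q (y i) (y j)
    = \prod_(j < n | j != i) (Z (q^-1 * y i) - Z (y j)) / D.
  by rewrite -prodf_div; apply: eq_bigr => j _; rewrite ffun_betheE.
have -> : \prod_(j < n | j != i) hfun_bethe q (y i) (y j)
    = \prod_(j < n | j != i) (Z (q * y i) - Z (y j)) / D.
  by rewrite -prodf_div; apply: eq_bigr => j _; rewrite hfun_betheE.
have -> : \prod_(j < n | j != i) (bfun (y i * (y j)^-1) * bfun (q * y i * y j)) = D.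
  by apply: eq_bigr => j _; rewrite Zfun_sub.
move: (\prod_(j < n | _) _) (\prod_(j < n | _) _) D0 => M P; clearbody D => D0.
move: (_.[_]) => X.
have [_] := ynt i; move: (y i) (y0 i) (by0 i) => u u0 bu bu2.
rewrite /Lambda1 /Lambda2 /nu_tilde /sgb /=.
rewrite expr1z expr1z expr0 expr1.
have -> : u ^ (-1) = u^-1 by rewrite -invr_expz expr1z.
have -> : q ^ (n%:Z - 1) = q ^+ n / q by rewrite expfzDr // -invr_expz expr1z.
have -> : q ^+ (1 + 2 * n) = q * q ^+ n ^+ 2 by rewrite exprD mulnC exprM.
have -> : q ^+ n.+1 = q * q ^+ n by rewrite exprS.
set R := (X in _ -> _ = X); set L := (X in _ -> X = _); move=> E1.
(* The Bethe expression is b(u^2) / (b(q) D) times R - L, a factor that is nonzero by non-triviality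
   and admissibility. *)
suff : (u ^+ 2 - u ^- 2) / (q - q^-1) / D * (R - L) = 0.
  move=> /eqP; rewrite !mulf_eq0 !invr_eq0 subr_eq0 (negPf bu2) (negPf qm0) (negPf D0) /=.
  by rewrite subr_eq0 => /eqP.
have [_ qk] := nru; have q1 : q * q - 1 != 0 by rewrite subr_eq0 -expr2 qk.
have bu' : q * u ^+ 2 * (q * u ^+ 2) - 1 != 0.
  apply: contraNneq bu => h; apply/eqP.
  have -> : q * u ^+ 2 - q^-1 * u ^- 2 = (q * u ^+ 2 * (q * u ^+ 2) - 1) / (q * u ^+ 2).
    by field; rewrite q0 u0.
  by rewrite h mul0r.
rewrite -[RHS]E1 /L /R /coefM /coefP /bfun.
move: (q ^+ n) (expf_neq0 n q0) => t t0.
by field; rewrite D0 q0 q1 u0 b0 t0 z0 bu'.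
Qed.

(** Identifies the multiplier of f found in [actA_bethe] with the prescribed eigenvalue. *)
Lemma eigval_plusE n (y : 'I_n -> F) : not_root_of_unity q -> z != 0 ->
  q ^+ n ^+ 2 * (beta q (q ^+ n) b c bs z - q^-1 * bs * \sum_i Z (y i))
    + q * q ^+ n ^+ 2 * bs * \sum_(k < n.+1) zroot q (q ^+ n) z k = eigval_plus p y.
Proof.
move=> nru z0; have [q0 qm0 _ _] := nru_neq0 nru.
have t0 : q ^+ n != 0 by rewrite expf_neq0.
have E := sum_zroot q0 t0 z0 erefl.
rewrite /eigval_plus /qnum /beta -/(zt z); set s := \sum_(j < n) _; rewrite -/s.
have -> : \sum_(k < n.+1) zroot q (q ^+ n) z k = zt z * (q * q ^+ n - (q * q ^+ n)^-1) / (q - q^-1).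
  by rewrite -E mulrC mulKf.
have -> : q ^+ (2 * n) = q ^+ n ^+ 2 by rewrite mulnC exprM.
have [_ qk] := nru; have q1 : q * q - 1 != 0 by rewrite subr_eq0 -expr2 qk.
move: (q ^+ n) t0 => t t0; clearbody s.
by field; rewrite q0 q1 t0.
Qed.

(** The denominator is cleared so that n = 0 is covered: there cs - q^2 bs may vanish, while the
    correction carries the factor 1 - t^-2 = 0. *)
Lemma A_mx_first n : not_root_of_unity q -> generic_param n p -> 
  A_mx n p ord0 ord0 * (cs - q ^+ 2 * bs) = (b + c) * (cs - q ^+ 2 * bs)
    - (1 - q ^+ n ^- 2) * (c * cs + b * bs * q ^+ 2 * q ^+ n ^+ 2 + q * q ^+ n * b * c * zt z).
Proof.
move=> nru [[b0 c0 bs0 cs0 z0] bc gen]; have [q0 _ _ _] := nru_neq0 nru.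
have t0 : q ^+ n != 0 by rewrite expf_neq0.
rewrite /A_mx mxE /= /coef_dn /coef_up /theta_star /=.
have -> : 1 - q ^ (2 * 0%:Z) = 0 by rewrite mulr0 expr0z subrr.
rewrite !(mul0r, mulr0, subr0) !expr0z ?oppr0 ?expr0z !mulr1.
have [n0|n0] := posnP n.
  by rewrite n0 mulr0 subr0 mulr1 subrr expr0 expr1n invr1 subrr !mul0r !subr0.
have := gen 1%N; rewrite muln1 => /(_ _)[]; first by move: n0; clear; lia.
move=> _ g1; have := gen 0%N isT; rewrite muln0 expr0 !mulr1 => -[_ g0].
have -> : q ^ (2 * (0%:Z + 1) - 2 * n%:Z - 2) = q ^+ n ^- 2.
  by rewrite -exprzN2; congr (_ ^ _); clear; lia.
have -> : q ^ (2 * (0%:Z + 1) + n%:Z - 1) = q * q ^+ n.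
  by rewrite -exprS exprnP; congr (_ ^ _); clear; lia.
have cE : c = bs * cs / b by rewrite -bc; field; exact: b0.
have -> : q ^ (4 * (0%:Z + 1) - 2) = q ^+ 2 by [].
rewrite /zt cE; move: (q ^+ n) t0 => t t0.
by field; rewrite t0 b0 z0 g1 g0 oner_neq0.
Qed.

Lemma A_mx_last n : not_root_of_unity q -> generic_param n p -> 
  A_mx n p ord_max ord_max * (bs * q ^+ n ^+ 2 - q ^+ 2 * (cs / q ^+ n ^+ 2))
    = (b + c) * (bs * q ^+ n ^+ 2 - q ^+ 2 * (cs / q ^+ n ^+ 2))
    - (1 - q ^+ n ^- 2) * (c * (bs * q ^+ n ^+ 2) + b * (cs / q ^+ n ^+ 2) * q ^+ 2 * q ^+ n ^+ 2
        + q * q ^+ n * b * c * zt z).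
Proof.
move=> nru [[b0 c0 bs0 cs0 z0] bc gen]; have [q0 _ _ _] := nru_neq0 nru.
have t0 : q ^+ n != 0 by rewrite expf_neq0.
rewrite /A_mx mxE /= /coef_dn /coef_up /theta_star /=.
rewrite !(ltn_eqF (ltnSn n)) eqxx.
have -> : 1 - q ^ (2 * (n%:Z + 1) - 2 * n%:Z - 2) = 0.
  by rewrite (_ : 2 * (n%:Z + 1) - 2 * n%:Z - 2 = 0) ?expr0z ?subrr //; clear; lia.
rewrite mulr0 !(mul0r, mulr0, subr0) !expr0z ?oppr0 ?expr0z !mulr1.
have [n0|n0] := posnP n.
  by rewrite n0 mulr0 expr0z expr0 expr1n invr1 subrr !(mul0r, mulr0) !subr0.
have [_ g1] := gen (2 * n - 1)%N ltac:(by clear; lia).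
have [_ g0] := gen (2 * n)%N (leqnn _).
have -> : q ^ (2 * n%:Z + 2 * n%:Z) = q ^+ n ^+ 2 ^+ 2.
  by rewrite expfzDr // !exprz2.
have -> : q ^ (4 * n%:Z) = q ^+ n ^+ 2 ^+ 2.
  by rewrite (_ : 4 * n%:Z = 2 * n%:Z + 2 * n%:Z) ?expfzDr ?exprz2 //; clear; lia.
have -> : q ^ (2 - 2 * n%:Z) = q ^+ 2 / q ^+ n ^+ 2 by rewrite expfzDr // exprzN2.
have q2 (k : int) : q ^ (k - 2) = q ^ k / q ^+ 2 by rewrite expfzDr // -invr_expz.
rewrite !q2 exprz2 (_ : q ^ (4 * n%:Z) = q ^+ n ^+ 2 ^+ 2); last first.
  by rewrite (_ : 4 * n%:Z = 2 * n%:Z + 2 * n%:Z) ?expfzDr ?exprz2 //; clear; lia.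
have -> : q ^ (n%:Z - 1) = q ^+ n / q by rewrite expfzDr // -invr_expz expr1z.
have e0 : q ^+ (2 * (2 * n)) = q ^+ n ^+ 2 ^+ 2 by rewrite -!exprM; congr (_ ^+ _); clear; lia.
have e1 : q ^+ (2 * (2 * n - 1)) = q ^+ n ^+ 2 ^+ 2 / q ^+ 2.
  by rewrite -e0 -expfB //; [congr (_ ^+ _)|]; move: n0; clear; lia.
rewrite {}e0 in g0; rewrite {}e1 in g1.
have cE : c = bs * cs / b by rewrite -bc; field; exact: b0.
rewrite /zt cE; move: (q ^+ n) t0 g0 g1 => t t0 g0 g1.
have g1' : q ^+ 2 * cs - bs * t ^+ 2 ^+ 2 != 0.
  have := mulf_neq0 g1 (expf_neq0 2 q0); apply: contraNneq => h.
  by apply/eqP; rewrite -[RHS]h; field.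
by field; rewrite z0 b0 t0 q0 oner_neq0 [t ^+ 4](exprM t 2 2) g0 [cs * _]mulrC g1'.
Qed.

End ScalarIdentities.

(** * Bethe strings in the representation *)

Lemma prod_ratio (F : fieldType) n (x : 'I_n.+1 -> F) : (forall i, x i != 0) ->
  \prod_(i < n) (x (widen_ord (leqnSn n) i) / x (lift ord0 i)) = x ord0 / x ord_max.
Proof.
move=> x0; elim: n x x0 => [|n IH] x x0.
  by rewrite big_ord0 (_ : ord_max = ord0) ?divff //; apply: val_inj.
rewrite big_ord_recr /=.
have := IH (fun i => x (widen_ord (leqnSn n.+1) i)) (fun i => x0 _).
have -> : widen_ord (leqnSn n.+1) (ord0 : 'I_n.+1) = ord0 by apply: val_inj.
have -> : lift ord0 (ord_max : 'I_n.+1) = ord_max by apply: val_inj.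
move=> E; rewrite -(mulfVK (x0 (widen_ord (leqnSn n.+1) ord_max)) (x ord0)).
rewrite -[x ord0 / _ * _ / _]mulrA -E; congr (_ * _); apply: eq_bigr => i _.
by congr (x _ / x _); apply: val_inj.
Qed.

Section Representation.

Context {F : fieldType} {V : vectType F} {n : nat}.
Variables (kets : 'I_n.+1 -> V) (bras : 'I_n.+1 -> 'Hom(V, F^o)) (xis : 'I_n.+1 -> F).
Hypothesis kets_basis : basis_of fullv (codom kets).
Hypothesis bras_kets : forall i j, bras i (kets j) = if i == j then xis j else 0.
Hypothesis xis0 : forall i, xis i != 0.
Implicit Types (X Y : 'End(V)) (M : 'M[F]_n.+1).

Definition represents X M := forall j, X (kets j) = \sum_i M i j *: kets i.

Lemma bra_sum i (a : 'I_n.+1 -> F) : bras i (\sum_k a k *: kets k) = a i * xis i.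
Proof.
rewrite linear_sum (bigD1 i) //= big1 ?addr0 => [|k ki]; rewrite linearZ /= bras_kets ?eqxx //.
by rewrite eq_sym (negPf ki) scaler0.
Qed.

Lemma represents_inj X M M' : represents X M -> represents X M' -> M = M'.
Proof.
move=> h h'; apply/matrixP => i j; apply: (mulIf (xis0 i)).
by rewrite -(bra_sum i (fun k => M k j)) -(bra_sum i (fun k => M' k j)) -h -h'.
Qed.

Lemma represents_id : represents \1%VF 1%:M.
Proof.
move=> j; rewrite id_lfunE (bigD1 j) //= big1 ?addr0 => [|k kj]; rewrite mxE ?eqxx ?scale1r //.
by rewrite (negPf kj) scale0r.
Qed.

Lemma represents_comp X Y M M' : represents X M -> represents Y M' ->
  represents (X \o Y)%VF (M *m M').
Proof.
move=> hX hY j; rewrite comp_lfunE hY linear_sum /=.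
under eq_bigr => k _ do rewrite linearZ /= hX scaler_sumr.
rewrite exchange_big /=; apply: eq_bigr => i _.
by rewrite mxE scaler_suml; apply: eq_bigr => k _; rewrite scalerA mulrC.
Qed.

Lemma representsZ a X M : represents X M -> represents (a *: X) (a *: M).
Proof.
move=> h j; rewrite scale_lfunE h scaler_sumr; apply: eq_bigr => i _.
by rewrite mxE scalerA.
Qed.

Lemma representsD X Y M M' : represents X M -> represents Y M' ->
  represents (X + Y) (M + M').
Proof.
move=> hX hY j; rewrite add_lfunE hX hY -big_split; apply: eq_bigr => i _.
by rewrite /= mxE scalerDl.
Qed.

Lemma representsB X Y M M' : represents X M -> represents Y M' ->
  represents (X - Y) (M - M').
Proof.
by move=> hX hY; rewrite -scaleN1r -[- M']scaleN1r; apply/representsD/representsZ.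
Qed.

Lemma represents_scalar a : represents (a *: \1%VF) a%:M.
Proof. by rewrite -scalemx1; apply/representsZ/represents_id. Qed.

Lemma eq_on_kets (vT : vectType F) (f g : 'Hom(V, vT)) : (forall j, f (kets j) = g (kets j)) -> f = g.
Proof.
move=> h; apply/lfunP => v; have := memvf v; rewrite -(span_basis kets_basis).
by move: v; apply/span_lfunP => _ /codomP[j ->].
Qed.

Lemma bra_comp i X M : represents X M -> forall j, (bras i \o X)%VF (kets j) = M i j * xis i.
Proof. by move=> h j; rewrite comp_lfunE h (bra_sum i (fun k => M k j)). Qed.

(** Otherwise the span of the kets in P is invariant under X and Y; it contains [kets i], and it is
    proper since [bras j] kills it. *)
Lemma invariant_irreducible (X Y : 'End(V)) (M : 'M_n.+1) (d : 'I_n.+1 -> F) (P : pred 'I_n.+1) i j :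
  (forall U : {vspace V}, (X @: U <= U)%VS -> (Y @: U <= U)%VS -> U = 0%VS \/ U = fullv) ->
  represents X M -> (forall k, Y (kets k) = d k *: kets k) ->
  P i -> ~~ P j -> exists k l, [/\ P l, ~~ P k & M k l != 0].
Proof.
move=> irr hX hY Pi Pj.
have [/existsP[k /existsP[l /and3P[h1 h2 h3]]]|none] :=
    boolP [exists k, exists l, [&& P l, ~~ P k & M k l != 0]]; first by exists k, l.
have M0 k l : P l -> ~~ P k -> M k l = 0.
  move=> Pl Pk; apply/eqP; apply: contraNT none => Mkl.
  by apply/existsP; exists k; apply/existsP; exists l; rewrite Pl Pk.
pose U := (\sum_(k | P k) <[kets k]>)%VS.
have kU k : P k -> kets k \in U.
  by move=> Pk; apply: (subvP (sumv_sup k Pk (subvv _))); rewrite memv_line.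
have XU (Z : 'End(V)) : (forall k, P k -> Z (kets k) \in U) -> (Z @: U <= U)%VS.
  move=> h; rewrite limg_sum; apply/subv_sumP => k Pk; rewrite limg_line.
  by rewrite -memvE; apply: h.
have [||U0|Uf] := irr U.
- apply: XU => l Pl; rewrite hX memv_suml // => k _.
  have [Pk|Pk] := boolP (P k); first by rewrite memvZ ?kU.
  by rewrite M0 // scale0r mem0v.
- by apply: XU => l Pl; rewrite hY memvZ ?kU.
- have := kU _ Pi; rewrite U0 memv0 => /eqP e.
  by have := bras_kets i i; rewrite e linear0 eqxx => /eqP; rewrite eq_sym (negPf (xis0 i)).
have : (U <= lker (bras j))%VS.
  apply/subv_sumP => k Pk; rewrite -memvE memv_ker bras_kets ifF //.
  by apply: contraNF Pj => /eqP->.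
move/subvP/(_ (kets j)); rewrite Uf memvf memv_ker bras_kets eqxx => /(_ isT).
by rewrite (negPf (xis0 j)).
Qed.

End Representation.

Lemma qcomm_qcomm (F : fieldType) (V : vectType F) (q : F) (X Y : 'End(V)) : q != 0 ->
  qcomm q^-1 X (qcomm q X Y)
   = (X \o X \o Y)%VF - (q ^+ 2 + q ^- 2) *: (X \o Y \o X)%VF + (Y \o X \o X)%VF.
Proof.
move=> q0; rewrite /qcomm; apply/lfunP => v.
rewrite !(add_lfunE, opp_lfunE, scale_lfunE, comp_lfunE) !(linearB, linearZ) /=.
rewrite invrK !(scalerN, opprK) scalerDr !(scalerN, scalerA) !mulfV // !scale1r.
by rewrite scalerDl -invfM -!expr2 opprD !addrA; congr (_ + _); rewrite addrAC.
Qed.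

(* The hypotheses that survive the symmetry [flipp]: only one of the two
   tridiagonal actions is recorded, and the relations are expanded. *)
Record half_pair (F : fieldType) (V : vectType F) n (p : awParam F)
    (A As : 'End(V)) (kets : 'I_n.+1 -> V) : Prop := HalfPair {
  hp_irreducible : forall W : {vspace V},
    (A @: W <= W)%VS -> (As @: W <= W)%VS -> W = 0%VS \/ W = fullv;
  hp_rel1 : (A \o A \o As)%VF = (aw_q p ^+ 2 + aw_q p ^- 2) *: (A \o As \o A)%VF
    - (As \o A \o A)%VF + (rho p *: As + omega n p *: A + Defs.eta n p *: \1%VF);
  hp_rel2 : (As \o As \o A)%VF = (aw_q p ^+ 2 + aw_q p ^- 2) *: (As \o A \o As)%VF
    - (A \o As \o As)%VF + (rho p *: A + omega n p *: As + eta_star n p *: \1%VF);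
  hp_basis : basis_of fullv (codom kets);
  hp_eigen : forall N, As (kets N) = theta_star p N%:Z *: kets N;
  hp_tridiag : forall N, A (kets N) = \sum_(N' < n.+1) A_mx n p N' N *: kets N' }.

(** * The plus string: eigenvector property and normalization *)

Section PlusString.

Context {F : fieldType} {V : vectType F} {n : nat}.
Variables q b c bs cs z : F.
Local Notation p := (AWParam q b c bs cs z).
Variables (A As : 'End(V)) (kets : 'I_n.+1 -> V).
Variables (bras : 'I_n.+1 -> 'Hom(V, F^o)) (xis : 'I_n.+1 -> F).
Hypothesis nru : not_root_of_unity q.
Hypothesis gen : generic_param n p.
Hypothesis hp : half_pair p A As kets.
Hypothesis bras_kets : forall i j, bras i (kets j) = if i == j then xis j else 0.
Hypothesis xis0 : forall i, xis i != 0.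

Local Notation t := (q ^+ n).
Local Notation D := (diag_mx (\row_(i < n.+1) dual_ev q bs cs i)).
Local Notation W := (Wmx q b c bs cs z (A_mx n p)).

Let repA : represents kets A (A_mx n p).
Proof. exact: hp_tridiag hp. Qed.

Let repS : represents kets As D.
Proof.
move=> j; rewrite (hp_eigen hp) (bigD1 j) //= big1 ?addr0 => [|i ij].
  by rewrite !mxE eqxx mulr1n /theta_star /dual_ev /= exprz2 exprzN2.
by rewrite !mxE (negPf ij) mulr0n scale0r.
Qed.

Let rhoE : rho p = aw_rho q b c. Proof. by []. Qed.

Let expqS : q ^+ n.+1 = q * t. Proof. exact: exprS. Qed.

Let omegaE : omega n p = @aw_omega F n q b c bs cs z.
Proof. by rewrite /omega /aw_omega /zt expqS. Qed.

Let etaE : Defs.eta n p = @aw_eta F n q b c bs cs z.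
Proof. by rewrite /Defs.eta /aw_eta /zt expqS. Qed.

Let eta_starE : eta_star n p = @aw_eta_star F n q b c bs cs z.
Proof.
by rewrite /eta_star /= /aw_eta_star /zt expqS exprVn invrK [z ^- 2 + _]addrC.
Qed.

Let R1 : A_mx n p *m A_mx n p *m D = (q ^+ 2 + q ^- 2) *: (A_mx n p *m D *m A_mx n p)
  - D *m A_mx n p *m A_mx n p
  + (aw_rho q b c *: D + @aw_omega F n q b c bs cs z *: A_mx n p + (@aw_eta F n q b c bs cs z)%:M).
Proof.
apply: (represents_inj bras_kets xis0 (X := (A \o A \o As)%VF)).
  by do !apply: represents_comp.
rewrite (hp_rel1 hp) rhoE omegaE etaE; apply: representsD.
  by apply: representsB; [apply: representsZ|]; do !apply: represents_comp.
by apply: representsD; [apply: representsD; apply: representsZ|apply: represents_scalar].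
Qed.

Let R2 : D *m D *m A_mx n p = (q ^+ 2 + q ^- 2) *: (D *m A_mx n p *m D)
  - A_mx n p *m D *m D
  + (aw_rho q b c *: A_mx n p + @aw_omega F n q b c bs cs z *: D + (@aw_eta_star F n q b c bs cs z)%:M).
Proof.
apply: (represents_inj bras_kets xis0 (X := (As \o As \o A)%VF)).
  by do !apply: represents_comp.
rewrite (hp_rel2 hp) rhoE omegaE eta_starE; apply: representsD.
  by apply: representsB; [apply: representsZ|]; do !apply: represents_comp.
by apply: representsD; [apply: representsD; apply: representsZ|apply: represents_scalar].
Qed.

Let Atri (i j : 'I_n.+1) : (i.+1 < j)%N || (j.+1 < i)%N -> A_mx n p i j = 0.
Proof.
move=> h; rewrite /A_mx mxE -val_eqE /=.
by rewrite !ifF //; apply/negP => /eqP e; move: h; rewrite e; clear; lia.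
Qed.

(** Irreducibility gives a nonzero entry leaving the initial segment 0..j, and tridiagonality
    locates it at (j+1, j). [Aup] uses final segments instead. *)
Let Alow (i j : 'I_n.+1) : i = j.+1 :> nat -> A_mx n p i j != 0.
Proof.
move=> ij.
have Pi : ~~ (i <= j)%N by rewrite ij ltnn.
have [k [l [/= h1 h2 h3]]] := invariant_irreducible bras_kets xis0 (P := fun k : 'I_n.+1 => (k <= j)%N)
  (hp_irreducible hp) repA (hp_eigen hp) (leqnn j) Pi.
move: h2; rewrite -ltnNge => h2.
have [lk|lk] := ltnP l.+1 k; first by move: h3; rewrite Atri ?eqxx // lk orbT.
have -> : i = k by apply: val_inj; move: h1 h2 lk ij => /=; clear; lia.
by have -> : j = l by apply: val_inj; move: h1 h2 lk ij => /=; clear; lia.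
Qed.

Let Aup (i j : 'I_n.+1) : j = i.+1 :> nat -> A_mx n p i j != 0.
Proof.
move=> ij.
have Pi : ~~ (j <= i)%N by rewrite ij ltnn.
have [k [l [/= h1 h2 h3]]] := invariant_irreducible bras_kets xis0 (P := fun k : 'I_n.+1 => (j <= k)%N)
  (hp_irreducible hp) repA (hp_eigen hp) (leqnn j) Pi.
move: h2; rewrite -ltnNge => h2.
have [lk|lk] := ltnP k.+1 l; first by move: h3; rewrite Atri ?eqxx // lk.
have -> : i = k by apply: val_inj; move: h1 h2 lk ij => /=; clear; lia.
by have -> : j = l by apply: val_inj; move: h1 h2 lk ij => /=; clear; lia.
Qed.

Let represents_Bop chi u :
  represents kets (Bop n p A As chi u)
    ((- chi * bfun (u ^+ 2) / (q ^+ 2 - q ^- 2)) *: (W - (Zfun q u)%:M)).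
Proof.
have [q0 qm0 qp0 q20] := nru_neq0 nru; have [[b0 c0 bs0 cs0 z0] bc _] := gen.
have H : represents kets (Bop n p A As chi u) ((chi * bfun (u ^+ 2)) *:
   ((rho p)^-1 *: (q *: (D *m A_mx n p) - q^-1 *: (A_mx n p *m D)
       + (omega n p / (q - q^-1))%:M)
    + ((q * u ^+ 2 + q^-1 * u ^- 2) / (q ^+ 2 - q ^- 2))%:M)).
  apply: representsZ; apply: representsD; last exact: represents_scalar.
  apply: representsZ; apply: representsD; last exact: represents_scalar.
  by apply: representsB; apply: representsZ; apply: represents_comp.
move: H; congr represents.
rewrite /Wmx omegaE rhoE /Zfun; move: (_ - _ + _) => Y.
apply/matrixP => i j; rewrite !mxE /aw_rho; move: (Y i j) => y.
have [_ qk] := nru; have q4 : (q * q) ^+ 2 - 1 != 0 by rewrite -expr2 -exprM subr_eq0 qk.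
have den : - (b * c * ((q * q) ^+ 2 - 1) ^+ 2) != 0.
  by rewrite oppr_eq0 !mulf_neq0 ?expf_neq0.
case: eqVneq => [_|_]; rewrite ?mulr1n ?mulr0n; move: (bfun _) (u ^- 2) => x y'.
  by field; rewrite q0 b0 c0 q4 den.
by field; rewrite q0 b0 c0 q4 den.
Qed.

Let represents_string chi beta m (v : 'I_m -> F) (m0 : int) :
  represents kets (\big[(@comp_lfun F V V V)/(\1%VF)]_(i < m)
      Cplus n p A As chi beta (v i) (m0 + 2 * i.+1%:Z))
    ((\prod_(i < m) (beta^-1 * q ^ (m0 + 2 * i.+1%:Z - 2) * (v i)^-1
        * (- chi * bfun (v i ^+ 2) / (q ^+ 2 - q ^- 2)))) *:
     horner_mx W (\prod_(i < m) ('X - (Zfun q (v i))%:P))).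
Proof.
rewrite rmorph_prod -scaler_prod /=.
apply: (big_rec2 (represents kets)); first exact: represents_id.
move=> i M E _ h; apply: represents_comp h.
rewrite -scalerA; apply: representsZ.
by rewrite rmorphB /= horner_mx_X horner_mx_C; apply: represents_Bop.
Qed.

Let W_hess (i j : 'I_n.+1) : (i.+1 < j)%N -> W i j = 0.
Proof.
move=> ij; rewrite Wmx_entry Atri ?ij // -val_eqE /= ltn_eqF ?mulr0n ?addr0 ?mulr0 //.
exact: ltn_trans ij.
Qed.

(** The value at the last ket is a product of superdiagonal entries, W_{k-1,k} = q^(1-2k) A_{k-1,k}
    / bs; the condition on beta makes the powers of q cancel factor by factor. *)
Lemma Psi_plus_last chi beta m0 (v : 'I_n -> F) :
  chi != 0 -> (q ^+ 2 - q ^- 2) * chi^-1 * beta * bs * q ^ (- m0 + 2) = 1 ->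
  nontrivial v ->
  Ntilde_star p xis v * Psi_plus p A As bras chi beta m0 v (kets ord_max) = xis ord_max.
Proof.
move=> chi0 betaE vnt; have [q0 qm0 qp0 q20] := nru_neq0 nru.
have [[b0 c0 bs0 cs0 z0] bc _] := gen.
rewrite /Psi_plus /dual_string (bra_comp bras_kets _ (represents_string _ _ _ _)).
rewrite mxE -[horner_mx _ _ ord0 _]mul1r.
have -> : horner_mx W (\prod_(i < n) ('X - (Zfun q (v i))%:P)) ord0 ord_max
   = \prod_(i < n) W (widen_ord (leqnSn n) i) (lift ord0 i).
  have [_] := hessenberg_row (fun i => Zfun q (v i)) W_hess (leqnn n).
  rewrite -rowE mxE (_ : inord n = ord_max); last by apply: val_inj; rewrite /= inordK.
  move=> ->; apply: eq_bigr => i _; have := ltn_ord i => ilt.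
  by congr (W _ _); apply: val_inj; rewrite /= inordK // ltnS ltnW.
rewrite mul1r -big_split /= mulrA /Ntilde_star -big_split /=.
(* The ratios of norms hidden in [tilde] telescope and turn the norm of the reference state into
   that of the last state. *)
rewrite -[RHS](mulfVK (xis0 ord0)) -[xis ord_max / _]invf_div -(prod_ratio xis0) -prodfV.
congr (_ * _); apply: eq_bigr => i _.
set i1 := widen_ord _ _; set i2 := lift _ _; have i12 : i2 = i1.+1 :> nat by [].
have A0 := Aup i12; have [v0 v20] := vnt i.
rewrite Wmx_entry -val_eqE i12 ltn_eqF //= mulr0n addr0 /tilde /dual_ev.
have beta0 : beta != 0.
  by apply: contra_eq_neq betaE => ->; rewrite mulr0 !mul0r eq_sym oner_neq0.
have -> : beta^-1 = (q ^+ 2 - q ^- 2) * chi^-1 * bs * (q ^+ 2 / q ^ m0).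
  apply: (mulfI beta0); rewrite mulfV // -betaE expfzDr // -invr_expz; ring.
have -> : q ^ (m0 + 2 * i.+1%:Z - 2) = q ^ m0 * q ^+ i ^+ 2.
  by rewrite -exprz2 -expfzDr //; congr (_ ^ _); clear; lia.
rewrite (exprS q i); have qm := expfz_neq0 m0 q0; have qi := expf_neq0 i q0.
have bv : bfun (v i ^+ 2) != 0 by rewrite subr_eq0.
have [_ qk] := nru; have q4 : (q * q) ^+ 2 - 1 != 0 by rewrite -expr2 -exprM subr_eq0 qk.
have cE : c = bs * cs / b by rewrite -bc; field; exact: b0.
move: (xis i1) (xis0 i1) (xis i2) (xis0 i2) => x1 x10 x2 x20.
move: (q ^ m0) (q ^+ i) (A_mx n p i1 i2) qm qi A0 => y1 y2 y3 y10 y20 y30.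
move: (bfun _) bv => y4 y40; move: (v i) v0 => y5 y50; rewrite cE.
by field; rewrite x20 x10 y20 q0 b0 q4 cs0 bs0 y50 y10 chi0 y30 y40 oppr_eq0.
Qed.

Lemma Psi_plus_eigen chi beta m0 qh (v : 'I_n -> F) :
  qh ^+ 2 = q ->
  dual_bethe_solution p qh true v ->
  (Psi_plus p A As bras chi beta m0 v \o A)%VF
    = eigval_plus p v *: Psi_plus p A As bras chi beta m0 v.
Proof.
move=> qhE sol; have [q0 qm0 qp0 q20] := nru_neq0 nru.
have t0 : t != 0 by rewrite expf_neq0.
have [[b0 c0 bs0 cs0 z0] bc g] := gen.
have [Zinj v0 bv bethe] := Etilde_bethe nru qhE b0 z0 sol.
have E := actA_bethe q0 t0 b0 z0 bc erefl Zinj v0 bv bethe.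
rewrite (eigval_plusE b c bs cs v nru z0) in E.
have g' k : (k <= 2 * n)%N -> cs - bs * q ^+ (2 * k) != 0 by case/g.
have Af := A_mx_first nru gen; have Al := A_mx_last nru gen.
have Zr := zpoly_row0 nru b0 c0 bs0 cs0 z0 bc R1 R2 g' Atri Alow Af Al.
have eA := first_row nru b0 c0 cs0 bc Atri Af.
have eS : delta_mx 0 ord0 *m D = (bs + cs) *: (delta_mx 0 ord0 : 'rV_n.+1).
  rewrite -rowE; apply/rowP => j; rewrite !mxE [j == _]eq_sym.
  by case: eqVneq => [_|_]; rewrite ?mulr0 // mulr1 /dual_ev /= expr0 expr1n mulr1 divr1.
have [row_eig _] := row_act (W_A nru b0 c0 R1) (W_S nru b0 c0 bc R2) eA eS
  (\prod_(i < n) ('X - (Zfun q (v i))%:P)).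
(* The inhomogeneous part of T f drops out by [Zr], leaving the eigenvalue equation. *)
move: row_eig; rewrite {}E rmorphD /= !linearZ /= mulmxDr -!scalemxAr Zr scaler0 add0r => row_eig.
apply: (eq_on_kets (hp_basis hp)) => j.
rewrite /Psi_plus /dual_string -comp_lfunA scale_lfunE.
have rs := represents_string chi beta v m0.
rewrite (bra_comp bras_kets _ rs) (bra_comp bras_kets _ (represents_comp rs repA)).
have /rowP/(_ j) := row_eig; rewrite -!rowE -row_mul -scalemxAl.
move: (horner_mx _ _) (eigval_plus p v) (\prod_(i < n) _) => N lam K.
rewrite mxE [RHS]mxE [row _ _ _ _]mxE [in X in _ -> X]mxE => ->.
by rewrite [X in _ = _ *: (X * _)]mxE -[RHS]/(_ * _); ring.
Qed.

End PlusString.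

(** A left eigenvector for theta_M kills all other kets, hence is a multiple of [bra M]; evaluation
    on the last ket of the dual basis, through P, determines the multiple. *)
Theorem bra_Psi_plus (F : fieldType) (V : vectType F) n (p : awParam F) (qh : F)
    (A As : 'End(V)) (ket kets : 'I_n.+1 -> V) (P : 'M[F]_n.+1)
    (bra bras : 'I_n.+1 -> 'Hom(V, F^o)) (xi xis : 'I_n.+1 -> F)
    (chi beta : F) (m0 : int) (M : 'I_n.+1) (v : 'I_n -> F) :
  not_root_of_unity (aw_q p) -> qh ^+ 2 = aw_q p -> generic_param n p ->
  half_pair p A As kets ->
  basis_of fullv (codom ket) ->
  injective (fun M : 'I_n.+1 => theta p M%:Z) ->
  (forall M, A (ket M) = theta p M%:Z *: ket M) ->
  transition_matrix ket kets P ->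
  left_eigenbasis A (fun M => theta p M%:Z) ket bra xi ->
  left_eigenbasis As (fun N => theta_star p N%:Z) kets bras xis ->
  chi != 0 ->
  (aw_q p ^+ 2 - aw_q p ^- 2) * chi^-1 * beta * aw_bs p * aw_q p ^ (- m0 + 2) = 1 ->
  dS_plus p qh M v ->
  bra M = (Ntilde_star p xis v * (P M ord_max * (xi M / xis ord_max)))
            *: Psi_plus p A As bras chi beta m0 v.
Proof.
case: p => q b c bs cs z /= nru qhE gen hp kb thinj keig trans [_ bk xi0] [_ bks xis0]
  chi0 betaE [sol thE].
have last := Psi_plus_last (xis := xis) nru gen hp bks xis0 chi0 betaE (let: And4 x _ _ _ := sol in x).
have eig := Psi_plus_eigen (xis := xis) nru gen hp bks xis0 chi beta m0 qhE sol.
move: last eig; set psi := Psi_plus _ _ _ _ _ _ _ _ => last; rewrite -thE => eig.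
have psi0 M' : M' != M -> psi (ket M') = 0.
  move=> MM; have /lfunP/(_ (ket M')) := eig; rewrite comp_lfunE scale_lfunE keig linearZ.
  move/eqP; rewrite -subr_eq0 -scalerBl scaler_eq0 subr_eq0 (inj_eq thinj) (negPf MM).
  by move/eqP.
have psiE : psi = (psi (ket M) / xi M) *: bra M.
  apply: (eq_on_kets kb) => j; rewrite scale_lfunE bk; case: eqVneq => [<-|Mj].
    by rewrite -[RHS]/(_ * _) mulfVK.
  by rewrite (psi0 j) ?scaler0 1?eq_sym.
have psin : psi (kets ord_max) = psi (ket M) * P M ord_max.
  rewrite {1}psiE scale_lfunE trans (bra_sum (xis := xi) bk M (fun k => P k ord_max)).
  by rewrite -[LHS]/(_ * _); field.
rewrite psin in last; rewrite [X in _ = _ *: X]psiE scalerA.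
rewrite [X in X *: _](_ : _ = 1) ?scale1r //.
move: last (xi0 M) (xis0 ord_max); move: (Ntilde_star _ _ _) (psi _ : F) (P _ _) (xi M) (xis _).
move=> N x y w w' E w0 w'0.
have -> : N * (y * (w / w')) * (x / w) = N * (x * y) / w' by field; rewrite w0 w'0.
by rewrite E divff.
Qed.

(** * Symmetry between the two strings *)

(* Exchanging A and A^* together with q -> q^-1; [A^*, A]_q changes sign. *)
Definition flipp (F : fieldType) (p : awParam F) : awParam F :=
  let: AWParam q b c bs cs z := p in AWParam q^-1 cs bs c b z^-1.

Section Flip.

Context {F : fieldType}.
Variables q b c bs cs z : F.
Local Notation p := (AWParam q b c bs cs z).
Local Notation p' := (flipp p).
Hypothesis nru : not_root_of_unity q.
Hypotheses (b0 : b != 0) (c0 : c != 0) (bs0 : bs != 0) (cs0 : cs != 0) (z0 : z != 0).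
Hypothesis (bc : b * c = bs * cs).

Let q0 : q != 0. Proof. by case: nru. Qed.

Lemma not_root_of_unity_flip : not_root_of_unity q^-1.
Proof.
case: nru => _ qk; split=> [|k k0]; first by rewrite invr_eq0.
by rewrite exprVn -invr1 (inj_eq invr_inj) qk.
Qed.

Lemma generic_flip n : generic_param n p -> generic_param n p'.
Proof.
case=> _ _ g; split=> [||k kn]; [by rewrite ?invr_eq0|by rewrite mulrC -bc mulrC|].
have [g1 g2] := g k kn; have qk0 : q ^+ (2 * k) != 0 by rewrite expf_neq0.
rewrite exprVn; split.
  have -> : bs - cs / q ^+ (2 * k) = - (cs - bs * q ^+ (2 * k)) / q ^+ (2 * k) by field.
  by rewrite mulf_neq0 ?oppr_eq0 ?invr_eq0.
have -> : b - c / q ^+ (2 * k) = - (c - b * q ^+ (2 * k)) / q ^+ (2 * k) by field.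
by rewrite mulf_neq0 ?oppr_eq0 ?invr_eq0.
Qed.

Lemma theta_flip k : theta p' k = theta_star p k.
Proof. by rewrite /theta_star /= !exprz_inv opprK addrC. Qed.

Lemma theta_star_flip k : theta_star p' k = theta p k.
Proof. by rewrite /theta_star /= !exprz_inv opprK addrC. Qed.

Let qz0 (k : int) : q ^ k != 0. Proof. exact: expfz_neq0. Qed.

Let den_flip (d e x y : F) : x != 0 -> y != 0 ->
  ((d - e / x) * (d - e / y))^-1 = x * y * ((e - d * x) * (e - d * y))^-1.
Proof.
move=> x0 y0; rewrite -[RHS]invf_div; congr (_^-1); field; by rewrite x0 y0.
Qed.

(* The two values differ by powers of q that cancel, also when the
   denominators vanish. *)
Lemma coef_up_flip n k : coef_up n (dualp p') k = coef_up n p k.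
Proof.
rewrite /coef_up /= !exprz_inv invrK -!invr_expz den_flip //.
have E : q ^ (4 * k - 4) * q ^ (4 * k - 2)
    = q ^ (2 * k - 2 * n%:Z - 2) * q ^ (2 * k - 2) * (q ^ (2 * k + n%:Z - 1)) ^+ 2.
  rewrite expr2 -!expfzDr //; congr (_ ^ _); clear; lia.
rewrite {1}E; move: (((c - _) * _)^-1) (q ^ (2 * k - 2 * n%:Z - 2)) (q ^ (2 * k - 2)) (q ^ (2 * k + n%:Z - 1))
  (qz0 (2 * k - 2 * n%:Z - 2)) (qz0 (2 * k - 2)) (qz0 (2 * k + n%:Z - 1)).
move=> w x1 x2 x3 x10 x20 x30.
by field; rewrite x10 x20 x30 z0.
Qed.

Lemma coef_dn_flip n k : coef_dn n (dualp p') k = coef_dn n p k.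
Proof.
rewrite /coef_dn /= !exprz_inv invrK -!invr_expz den_flip //.
have E : q ^ (4 * k - 2) * q ^ (4 * k)
    = (q ^ (2 - 2 * n%:Z)) ^+ 2 * q ^ (2 * k) * q ^ (2 * k + 2 * n%:Z)
       * (q ^ (n%:Z - 1)) ^+ 2 * (q ^ (2 * k - 2)) ^+ 2.
  by rewrite !expr2 -!expfzDr //; congr (_ ^ _); clear; lia.
rewrite {1}E; move: (((c - _) * _)^-1) (q ^ (2 - 2 * n%:Z)) (q ^ (2 * k)) (q ^ (2 * k + 2 * n%:Z))
  (q ^ (n%:Z - 1)) (q ^ (2 * k - 2)) (qz0 (2 - 2 * n%:Z)) (qz0 (2 * k)) (qz0 (2 * k + 2 * n%:Z))
  (qz0 (n%:Z - 1)) (qz0 (2 * k - 2)).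
move=> w x1 x2 x3 x4 x5 x10 x20 x30 x40 x50.
by field; rewrite x10 x20 x30 x40 x50 z0.
Qed.

Lemma A_mx_flip n : A_mx n p' = Astar_mx n p.
Proof.
have E : theta_star (dualp p') 0 = theta_star p 0 by rewrite -theta_flip.
by apply/matrixP => i j; rewrite /A_mx !mxE !coef_up_flip !coef_dn_flip E.
Qed.

(** Inverting q, its square root and all v_i changes the sign of every b, and these signs cancel in
    pairs. *)
Lemma Etilde_flip n (qh : F) (v : 'I_n -> F) (i : 'I_n) : qh != 0 -> (forall i, v i != 0) -> bfun (q * v i ^+ 2) != 0 ->
  Etilde p' qh^-1 true (fun i => (v i)^-1) i = Etilde p qh false v i.
Proof.
move=> qh0 v0 bv; rewrite /Etilde /sgb /=.
have bV (x : F) : bfun x^-1 = - bfun x by rewrite /bfun invrK opprB.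
have -> : \prod_(j < n | j != i) ffun_bethe q^-1 (v i)^-1 (v j)^-1
    = \prod_(j < n | j != i) ffun_bethe q (v i) (v j).
  apply: eq_bigr => j _; rewrite /ffun_bethe -!invfM !bV.
  by rewrite !mulrNN.
have -> : \prod_(j < n | j != i) hfun_bethe q^-1 (v i)^-1 (v j)^-1
    = \prod_(j < n | j != i) hfun_bethe q (v i) (v j).
  apply: eq_bigr => j _; rewrite /hfun_bethe exprVn -!invfM !bV.
  by rewrite !mulrNN.
have -> : \prod_(j < n | j != i) (bfun ((v i)^-1 * (v j)^-1^-1) * bfun (q^-1 * (v i)^-1 * (v j)^-1))
    = \prod_(j < n | j != i) (bfun (v i * (v j)^-1) * bfun (q * v i * v j)).
  by apply: eq_bigr => j _; rewrite -!invfM !bV mulrNN.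
have -> : \prod_(k < n.+1) (bfun (qh^-1 ^ (1 + 2 * k%:Z - n%:Z) * z^-1 * (v i)^-1)
       * bfun (qh^-1 ^ (1 + 2 * k%:Z - n%:Z) * z^-1^-1 * (v i)^-1))
    = \prod_(k < n.+1) (bfun (qh ^ (1 + 2 * k%:Z - n%:Z) * z * v i)
       * bfun (qh ^ (1 + 2 * k%:Z - n%:Z) * z^-1 * v i)).
  by apply: eq_bigr => k _; rewrite !exprz_inv -!invr_expz -!invfM !bV mulrNN.
move: (_ / \prod_(j < n | j != i) _) (\prod_(j < n | j != i) _) (\prod_(j < n | j != i) _).
move: (v i) (v0 i) bv => u u0 bu X Y Z.
have bu' : q * u ^+ 2 * (q * u ^+ 2) - 1 != 0.
  apply: contraNneq bu => h; apply/eqP.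
  have -> : bfun (q * u ^+ 2) = (q * u ^+ 2 * (q * u ^+ 2) - 1) / (q * u ^+ 2).
    by rewrite /bfun; field; rewrite q0 u0.
  by rewrite h mul0r.
rewrite /Lambda1 /Lambda2 /nu_tilde /sgb /= !expr1 !expr0 !exprz_inv !expr1z.
rewrite -!invr_expz !expr1z.
have -> : q ^ (n%:Z - 1) = q ^+ n / q by rewrite expfzDr // -invr_expz expr1z.
rewrite !(exprS _ n) !exprVn.
have -> : q ^+ (1 + 2 * n) = q * q ^+ n ^+ 2 by rewrite exprD mulnC exprM.
have [_ qk] := nru; have q1 : q * q - 1 != 0 by rewrite subr_eq0 -expr2 qk.
move: (q ^+ n) (expf_neq0 n q0) => t t0; rewrite /bfun.
have q1' : 1 + - q * q != 0 by rewrite mulNr -opprB oppr_eq0.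
have bu'' : 1 + - (q * u ^+ 2) * (q * u ^+ 2) != 0 by rewrite mulNr -opprB oppr_eq0.
by field; rewrite q0 q1 u0 t0 cs0 z0 bu' oner_neq0 q1' bu''.
Qed.

Lemma eigval_flip n (v : 'I_n -> F) : eigval_minus p v = eigval_plus p' (fun i => (v i)^-1).
Proof.
rewrite /eigval_minus /eigval_plus /qnum /=.
have -> : \sum_(j < n) (q^-1 * (v j)^-1 ^+ 2 + q^-1^-1 * (v j)^-1 ^- 2)
    = \sum_(j < n) (q * v j ^+ 2 + q^-1 * v j ^- 2).
  by apply: eq_bigr => j _; rewrite !exprVn !invrK addrC.
move: (\sum_(j < n) _) => s.
have -> : q^-1 ^+ n - q^-1 ^- n = - (q ^+ n - q ^- n) by rewrite exprVn invrK opprB.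
have -> : q^-1 - q^-1^-1 = - (q - q^-1) by rewrite invrK opprB.
rewrite invrN mulrNN !exprVn !invrK; move: (_ / (q - q^-1)) => y.
ring.
Qed.

Lemma dual_bethe_solution_flip n (qh : F) (v : 'I_n -> F) : qh != 0 ->
  dual_bethe_solution p qh false v ->
  dual_bethe_solution p' qh^-1 true (fun i => (v i)^-1).
Proof.
move=> qh0 [vnt vadm bv E0]; have v0 i : v i != 0 by have [] := vnt i.
split.
- move=> i; have [_ v2] := vnt i; rewrite invr_eq0; split=> //.
  by rewrite !exprVn invrK eq_sym.
- move=> i j ij; move: (vadm i j ij); apply: contraNneq; rewrite /Yfun /= !exprVn !invrK.
  by rewrite ![q^-1 * _ + _]addrC ![q^-1 + q]addrC => ->.
- move=> i; have := bv i; rewrite /= exprVn -invfM /bfun invrK -opprB oppr_eq0.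
  by rewrite /bfun.
by move=> i; rewrite Etilde_flip.
Qed.

Lemma Ntilde_flip n (xi : 'I_n.+1 -> F) (v : 'I_n -> F) :
  Ntilde p xi v = Ntilde_star p' xi (fun i => (v i)^-1).
Proof.
rewrite /Ntilde /Ntilde_star A_mx_flip; apply: eq_bigr => i _; congr (_^-1); congr (_ * _).
by rewrite /= invrK exprVn /bfun invrK; ring.
Qed.

Lemma rho_flip : rho p' = rho p.
Proof. by rewrite /rho /= [cs * bs]mulrC -bc !exprVn !invrK; ring. Qed.

Lemma omega_flip n : omega n p' = omega n p.
Proof.
rewrite /omega /= [cs * bs]mulrC -bc !exprVn !invrK [z ^- 2 + _]addrC.
by rewrite [q ^- n.+1 + _]addrC; ring.
Qed.

Lemma eta_flip n : Defs.eta n p' = eta_star n p.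
Proof.
rewrite /Defs.eta /eta_star /= [cs * bs]mulrC !exprVn !invrK.
rewrite [q ^- n.+1 + _]addrC [q^-1 + q]addrC; move: ((q + q^-1)^-1) => y; ring.
Qed.

Lemma eta_star_flip n : eta_star n p' = Defs.eta n p.
Proof.
rewrite /Defs.eta /eta_star /= [c * b]mulrC !exprVn !invrK.
rewrite [q ^- n.+1 + _]addrC [q^-1 + q]addrC; move: ((q + q^-1)^-1) => y; ring.
Qed.

Section Operators.

Context {V : vectType F} {n : nat}.
Variables (A As : 'End(V)).

(** Every summand inside changes sign, and so does the prefactor b(u^2). *)
Lemma Bop_flip chi u : Bop n p' As A chi u^-1 = Bop n p A As chi u.
Proof.
rewrite /Bop rho_flip omega_flip /=.
have -> : qcomm q^-1 A As = - qcomm q As A by rewrite /qcomm invrK opprB.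
have -> : omega n p / (q^-1 - q^-1^-1) = - (omega n p / (q - q^-1)).
  by rewrite invrK -opprB invrN mulrN.
have -> : (q^-1 * u^-1 ^+ 2 + q^-1^-1 * u^-1 ^- 2) / (q^-1 ^+ 2 - q^-1 ^- 2)
    = - ((q * u ^+ 2 + q^-1 * u ^- 2) / (q ^+ 2 - q ^- 2)).
  by rewrite !exprVn !invrK [_ * u ^- 2 + _]addrC -[q ^- 2 - _]opprB invrN mulrN.
have -> : bfun (u^-1 ^+ 2) = - bfun (u ^+ 2) by rewrite exprVn /bfun invrK opprB.
by rewrite !scaleNr -opprD scalerN -opprD mulrN scaleNr scalerN opprK.
Qed.

Lemma Psi_flip (bra : 'I_n.+1 -> 'Hom(V, F^o)) chi beta m0 (v : 'I_n -> F) :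
  Psi_minus p A As bra chi beta m0 v = Psi_plus p' As A bra chi beta m0 (fun i => (v i)^-1).
Proof.
rewrite /Psi_minus /Psi_plus /dual_string; congr (_ \o _)%VF; apply: eq_bigr => i _.
rewrite /Cminus /Cplus Bop_flip /= invrK exprz_inv.
by congr ((_ * _ ^ _ * _) *: _); rewrite opprB.
Qed.

Lemma half_pair_Leonard (ket kets : 'I_n.+1 -> V) :
  AW_Leonard_pair p A As ket kets -> half_pair p A As kets.
Proof.
case=> _ irr r1 r2 _ _ _ kb _ ke _ kt _.
move: r1 r2; rewrite !qcomm_qcomm // => r1 r2.
by split=> //=; rewrite -?r1 -?r2 [RHS]addrC addrA [RHS]addrAC addrK subrK.
Qed.

Lemma half_pair_flip (ket kets : 'I_n.+1 -> V) :
  AW_Leonard_pair p A As ket kets -> half_pair p' As A ket.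
Proof.
case=> _ irr r1 r2 _ _ kb _ ke _ kt _ _.
move: r1 r2; rewrite !qcomm_qcomm // => r1 r2.
split=> [W WAs WA||||N|N] //; first exact: irr.
- rewrite rho_flip omega_flip eta_flip -r2 /= !exprVn !invrK [q ^- 2 + _]addrC.
  by rewrite [RHS]addrC addrA [RHS]addrAC addrK subrK.
- rewrite rho_flip omega_flip eta_star_flip -r1 /= !exprVn !invrK [q ^- 2 + _]addrC.
  by rewrite [RHS]addrC addrA [RHS]addrAC addrK subrK.
- by rewrite theta_star_flip.
by rewrite A_mx_flip.
Qed.

End Operators.

End Flip.

(** * Inverse transition matrix and both families of left eigenvectors *)

Lemma transition_inv (F : fieldType) (V : vectType F) n (ket kets : 'I_n.+1 -> V)
    (P : 'M[F]_n.+1) (bras : 'I_n.+1 -> 'Hom(V, F^o)) (xis : 'I_n.+1 -> F) :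
  basis_of fullv (codom kets) ->
  (forall i j, bras i (kets j) = if i == j then xis j else 0) -> (forall i, xis i != 0) ->
  transition_matrix ket kets P -> transition_matrix kets ket (invmx P).
Proof.
move=> kb bk xi0 trans.
have kb' : basis_of fullv [tuple kets i | i < n.+1].
  by move: kb; rewrite /codom /image_mem.
(* The coordinates of the kets form a left inverse of P, which shows that P is invertible and that
   [invmx P] is this matrix. *)
pose Q := \matrix_(i, j) coord [tuple kets i | i < n.+1] i (ket j).
have kQ j : ket j = \sum_i Q i j *: kets i.
  rewrite {1}(coord_basis kb' (memvf (ket j))); apply: eq_bigr => i _.
  by rewrite mxE -tnth_nth tnth_mktuple.
have QP : Q *m P = 1%:M.
  apply: (represents_inj bk xi0 (X := \1%VF)); last exact: represents_id.
  move=> j; rewrite id_lfunE trans.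
  under eq_bigr => k _ do rewrite kQ scaler_sumr.
  rewrite exchange_big /=; apply: eq_bigr => i _; rewrite mxE scaler_suml.
  by apply: eq_bigr => k _; rewrite scalerA mulrC.
have [_ Pu] := mulmx1_unit QP.
by have -> : invmx P = Q by rewrite -[RHS](mulmxK Pu) QP mul1mx.
Qed.

Theorem lemma3p8 (R : realType) (n : nat) (p : awParam R[i]) (qh : R[i])
    (V : vectType R[i]) (A As : 'End(V))
    (ket kets : 'I_n.+1 -> V) (P : 'M[R[i]]_n.+1)
    (bra bras : 'I_n.+1 -> 'Hom(V, R[i]^o)) (xi xis : 'I_n.+1 -> R[i])
    (chi beta_minus beta_plus : R[i]) (m0 : int) :
  not_root_of_unity (aw_q p) ->
  qh ^+ 2 = aw_q p ->
  generic_param n p ->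
  AW_Leonard_pair p A As ket kets ->
  transition_matrix ket kets P ->
  left_eigenbasis A (fun M => theta p M%:Z) ket bra xi ->
  left_eigenbasis As (fun N => theta_star p N%:Z) kets bras xis ->
  chi != 0 ->
  (aw_q p ^+ 2 - aw_q p ^- 2) * chi^-1 * beta_minus * aw_c p
    * aw_q p ^ (m0 - 2) = -1 ->
  (aw_q p ^+ 2 - aw_q p ^- 2) * chi^-1 * beta_plus * aw_bs p
    * aw_q p ^ (- m0 + 2) = 1 ->
  (forall M N : 'I_n.+1,
     (exists y : 'I_n -> R[i], dS_plus p qh M y)
     /\ (exists v : 'I_n -> R[i], dS_minus p qh N v)) ->
  forall M N : 'I_n.+1,
    (forall v' : 'I_n -> R[i], dS_plus p qh M v' ->
       bra M = (Ntilde_star p xis v' * (P M ord_max * (xi M / xis ord_max)))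
                 *: Psi_plus p A As bras chi beta_plus m0 v')
    /\
    (forall y' : 'I_n -> R[i], dS_minus p qh N y' ->
       bras N = (Ntilde p xi y' * (invmx P N ord_max * (xis N / xi ord_max)))
                  *: Psi_minus p A As bra chi beta_minus m0 y').
Proof.
case: p => q b c bs cs z nru qhE gen lp trans eb ebs chi0 bm bp _ M N; split=> v dS.
  have hp := half_pair_Leonard nru lp.
  case: lp dS => _ _ _ _ thinj _ kb _ ke _ _ _ _ dS.
  exact: (bra_Psi_plus nru qhE gen hp kb thinj ke trans eb ebs chi0 bp dS).
have [[b0 c0 bs0 cs0 z0] bc _] := gen; have [q0 _] := nru.
have qh0 : qh != 0.
  by apply: contraNneq q0 => h; move: qhE; rewrite h expr0n /= => <-.
have hp := half_pair_flip nru z0 bc lp.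
case: lp dS => _ _ _ _ _ thinj kb kbs ke kse _ _ _ [sol thE].
have [bras1 bras2 xis0] := ebs; have [bra1 bra2 xi0] := eb.
have trans' := transition_inv kbs bras2 xis0 trans.
rewrite (Psi_flip q z bc) (Ntilde_flip b c bs cs nru z0).
(* The roles of A and As and of the two bases are exchanged, and the square root of q is
   inverted. *)
apply: (@bra_Psi_plus _ _ _ (flipp (AWParam q b c bs cs z)) qh^-1 As A kets ket
  (invmx P) bras bra xis xi chi beta_minus m0 N) => //.
- exact: not_root_of_unity_flip.
- by rewrite exprVn qhE.
- exact: generic_flip.
- by move=> i j; rewrite !theta_flip; apply: thinj.
- by move=> K; rewrite theta_flip.
- by split=> // K; rewrite theta_flip.
- by split=> // K; rewrite theta_star_flip.
(* Inverting q changes the sign of q^2 - q^-2, which accounts for the -1 in the condition on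
   [beta_minus]. *)
- rewrite /= exprz_inv !exprVn invrK opprD opprK -[q ^- 2 - _]opprB !mulNr.
  by move: bm => /= ->; rewrite opprK.
split; last by rewrite theta_flip thE eigval_flip.
exact: (dual_bethe_solution_flip nru cs0 z0 qh0).
Qed.
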